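(* Let $n, r \in \mathbb{N}_0$, let $T$ be an oriented $n$-dimensional simplex with ordered vertices, and let $k \in [0:n]$. Let $\omega_{\alpha\sigma}$ be a family of complex numbers indexed over $\alpha \in A(r,n)$ and $\sigma \in \Sigma(k,n)$. Then $$\sum_{\alpha,\beta \in A(r,n)}\ \sum_{\sigma,\rho \in \Sigma(k,n)} \int_{T} \omega_{\alpha\sigma} \lambda^{\alpha} \lambda_{\sigma^c}\, \mathrm{d}\lambda_{\sigma} \wedge \epsilon(\rho,\rho^{c})\, \overline{\omega_{\beta\rho}}\, \lambda^{\beta}\, \phi_{\rho^{c}} = (-1)^{k} \sum_{\theta \in \Sigma(k+1,n)} \int_{T} \lambda_{\theta^c} \Big\vert \sum_{\beta \in A(r+1,n)} \sum_{p \in [\theta]\cap[\beta]} \epsilon(p,\theta-p)\, \lambda^{\beta} \omega_{\beta-p,\theta-p} \Big\vert^{2} \phi_{T}.$$ In particular, this quantity is zero if and only if one (equivalently, each) of the following equivalent conditions is satisfied: (a) $\sum_{\alpha \in A(r,n),\, \sigma \in \Sigma(k,n)} \epsilon(\sigma,\sigma^c)\, \omega_{\alpha\sigma} \lambda^{\alpha}\, \phi_{\sigma^c} = 0$; (b) $\sum_{\alpha \in A(r,n),\, \sigma \in \Sigma(k,n)} \omega_{\alpha\sigma} \lambda^{\alpha} \lambda_{\sigma^c}\, \mathrm{d}\lambda_{\sigma} = 0$; (c) $\omega_{\alpha\sigma} - \sum_{q \in [\sigma]\cap[\alpha]} \epsilon(\lfloor\sigma^c\rfloor,\sigma)\, \epsilon(q,\sigma-q)\,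 \omega_{\alpha+\lfloor\sigma^c\rfloor-q,\ \sigma+\lfloor\sigma^c\rfloor-q} = 0$ for all $\alpha \in A(r,n)$ and all $\sigma \in \Sigma(k,n)$ with $\lfloor\alpha\rfloor \geq \lfloor\sigma^c\rfloor$; (d) $\sum_{p \in [\theta]\cap[\beta]} \epsilon(p,\theta-p)\, \omega_{\beta-p,\theta-p} = 0$ for all $\beta \in A(r+1,n)$ and all $\theta \in \Sigma(k+1,n)$.
   Context: For integers $a,b$, $[a:b]=\{a,\dots,b\}$ (empty if $a>b$). An $n$-dimensional simplex $T$ is the convex hull of $n+1$ affinely independent points $v_0,\dots,v_n$ (its ordered vertices) in some Euclidean space. The barycentric coordinates $\lambda_0,\dots,\lambda_n$ are the affine functions on $T$ with $\lambda_i(v_j)=\delta_{ij}$, and $\mathrm{d}\lambda_i$ are their exterior derivatives (differential 1-forms on $T$); all differential forms on $T$ have complex-valued coefficients. The integral $\int_T$ of an $n$-form is taken with respect to the fixed orientation of $T$. A bar denotes complex conjugation. $A(r,n)$ is the set of maps $\alpha:[0:n]\to\mathbb{N}_0$ with $\sum_{i=0}^n\alpha(i)=r$; $[\alpha]=\{i : \alpha(i)>0\}$; $\lfloor\alpha\rfloor$ is the minimal element of $[\alpha]$ (and $\infty$ if $[\alpha]=\emptyset$); $\lambda^\alpha=\prod_{i=0}^n\lambda_i^{\alpha(i)}$. For an index $p$, $\alpha+p$ is $\alpha$ with its value at $p$ increased by one, and for $p\in[\alpha]$, $\alpha-p$ is $\alpha$ with its value at $p$ decreased by one. $\Sigma(k,n)$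 is the set of strictly increasing maps $[1:k]\to[0:n]$ (with $\Sigma(0,n)=\{\emptyset\}$), and $\Sigma_0(k,n)$ is the set of strictly increasing maps $[0:k]\to[0:n]$; $[\sigma]$ denotes the image of $\sigma$ and $\lfloor\sigma\rfloor$ its minimal element ($\infty$ if empty). For $\sigma$ in either set, $\mathrm{d}\lambda_\sigma$ is the wedge product of the $\mathrm{d}\lambda_{\sigma(i)}$ in increasing order of $i$ and $\lambda_\sigma$ is the product of the $\lambda_{\sigma(i)}$ (both equal to $1$ for $\sigma=\emptyset$). For $p\in[\sigma]$, $\sigma-p$ is the strictly increasing map with image $[\sigma]\setminus\{p\}$; for $q\notin[\sigma]$, $\sigma+q$ is the strictly increasing map with image $[\sigma]\cup\{q\}$. For $\sigma\in\Sigma(k,n)$, $\sigma^c\in\Sigma_0(n-k,n)$ is the strictly increasing map with image $[0:n]\setminus[\sigma]$; for the unique $\theta\in\Sigma(n+1,n)$ (which occurs when $k=n$) $\theta^c=\emptyset$ and $\lambda_{\theta^c}=1$. For $q\notin[\sigma]$, $\epsilon(q,\sigma)$ is the sign of the permutation sorting into ascending order the sequence consisting of $q$ followed by the values of $\sigma$ in order. $\epsilon(\sigma,\sigma^c)$ is the sign of the permutation sorting the values of $\sigma$ (in order) followed by the values of $\sigma^c$ (in order). For $\rho\in\Sigma_0(l,n)$ the Whitney form is $\phi_\rho=\sum_{p\in[\rho]}\epsilon(p,\rho-p)\,\lambda_p\,\mathrm{d}\lambda_{\rho-p}$, and $\phi_T:=\phi_{\rho_T}$ where $\rho_T$ is the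 identity map of $[0:n]$, the unique element of $\Sigma_0(n,n)$. *)

(* Defs.v *)
From HB Require Import structures.
From mathcomp Require Import all_boot all_order all_algebra all_fingroup.
From mathcomp Require Import all_classical all_reals all_analysis.
From mathcomp Require Import complex.
Set Implicit Arguments.
Unset Strict Implicit.
Unset Printing Implicit Defensive.
Import Order.TTheory GRing.Theory Num.Theory.
Import numFieldNormedType.Exports.
Local Open Scope ring_scope.

(* A(r,n), listed without repetition (see [mem_multis] and [multis_uniq]). *)
Definition multis r n : seq {ffun 'I_n.+1 -> nat} :=
  [seq [ffun i => b i : nat] |
     b : {ffun 'I_n.+1 -> 'I_r.+1} in
       [pred b : {ffun 'I_n.+1 -> 'I_r.+1} | \sum_i (b i : nat) == r]%N].

(* Sigma(k,n) is [incmaps k n] and Sigma_0(k,n) is [incmaps k.+1 n]: domains are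
   reindexed to start from 0. *)
Definition incmaps k n : {set {ffun 'I_k -> 'I_n.+1}} :=
  [set s : {ffun 'I_k -> 'I_n.+1} |
     [forall i : 'I_k, forall j : 'I_k, (i < j)%N ==> (s i < s j)%N]].

Section Indices.
Variable n : nat.
Implicit Types (r k l : nat) (A : {set 'I_n.+1}) (a : {ffun 'I_n.+1 -> nat}) (p q : 'I_n.+1).

Lemma mem_multis r a : (a \in multis r n) = (\sum_i a i == r)%N.
Proof.
apply/fintype.imageP/idP => [[b]|sa].
  by rewrite unfold_in /= => /eqP sb ->; under eq_bigr do rewrite ffunE; apply/eqP.
have la i : (a i < r.+1)%N.
  by rewrite ltnS -(eqP sa) (bigD1 i) //= leq_addr.
exists [ffun i => Ordinal (la i)].
  by rewrite unfold_in /=; under eq_bigr do rewrite ffunE.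
by apply/ffunP => i; rewrite !ffunE.
Qed.

Lemma multis_uniq r : uniq (multis r n).
Proof.
rewrite map_inj_uniq ?enum_uniq // => b c /ffunP bc.
by apply/ffunP => i; apply/val_inj; have := bc i; rewrite !ffunE.
Qed.

Definition msupp a : {set 'I_n.+1} := [set i | 0 < a i]%N.
Definition madd a p : {ffun 'I_n.+1 -> nat} := [ffun i => a i + (i == p)]%N.
Definition msub a p : {ffun 'I_n.+1 -> nat} := [ffun i => a i - (i == p)]%N.

(* The least element of A, with n+1 standing for the infinite value taken at the
   empty set: it exceeds every index. *)
Definition set_min (A : {set 'I_n.+1}) : nat := \big[minn/n.+1]_(i in A) i.

Definition img k (s : {ffun 'I_k -> 'I_n.+1}) : {set 'I_n.+1} :=
  [set s i | i in 'I_k].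

(* The increasing map on 'I_k with image A, meaningful when #|A| = k. *)
Definition incr k (A : {set 'I_n.+1}) : {ffun 'I_k -> 'I_n.+1} :=
  [ffun i : 'I_k => nth ord0 (enum A) i].

Lemma sorted_enum_ord (A : {set 'I_n.+1}) :
  sorted (fun i j : 'I_n.+1 => i < j)%N (enum A).
Proof.
rewrite {1}/enum_mem; apply: sorted_filter; first by move=> ? ? ?; exact: ltn_trans.
rewrite -enumT.
have := iota_ltn_sorted 0 n.+1.
by rewrite -val_enum_ord sorted_map.
Qed.

Lemma incr_incmaps k A : #|A| = k -> incr k A \in incmaps k n.
Proof.
move=> Ak; rewrite inE; apply/forallP => i; apply/forallP => j.
apply/implyP => ij; rewrite !ffunE.
apply: (@sorted_ltn_nth _ (fun i j : 'I_n.+1 => (i < j)%N)) => //;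
  rewrite ?inE -?cardE ?Ak ?ltn_ord //.
- by move=> ? ? ?; exact: ltn_trans.
- exact: sorted_enum_ord.
Qed.

Lemma img_incr k A : #|A| = k -> img (incr k A) = A.
Proof.
move=> Ak; apply/setP => x; apply/imsetP/idP => [[i _ ->]|xA].
  by rewrite ffunE -mem_enum mem_nth // -cardE Ak.
have ik : (index x (enum A) < k)%N by rewrite -Ak cardE index_mem mem_enum.
by exists (Ordinal ik) => //; rewrite ffunE /= nth_index // mem_enum.
Qed.

Lemma incmaps_inj k (s : {ffun 'I_k -> 'I_n.+1}) : s \in incmaps k n -> injective s.
Proof.
rewrite inE => /forallP sP i j sij; apply/val_inj => /=.
case: (ltngtP i j) => // ij.
- by have /forallP/(_ j)/implyP/(_ ij) := sP i; rewrite sij ltnn.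
- by have /forallP/(_ i)/implyP/(_ ij) := sP j; rewrite sij ltnn.
Qed.

Lemma incr_img k (s : {ffun 'I_k -> 'I_n.+1}) : s \in incmaps k n -> incr k (img s) = s.
Proof.
move=> sP; have sI := incmaps_inj sP.
have -> : incr k (img s) = [ffun i : 'I_k => nth ord0 (codom s) i].
  apply/ffunP => i; rewrite !ffunE; congr (nth _ _ _).
  apply: (@irr_sorted_eq _ (fun i j : 'I_n.+1 => (i < j)%N)) => //.
  - by move=> ? ? ?; exact: ltn_trans.
  - by move=> ?; rewrite /= ltnn.
  - exact: sorted_enum_ord.
  - move: sP; rewrite inE => /forallP sP.
    rewrite /codom /image_mem; apply: (homo_sorted (e := fun i j : 'I_k => (i < j)%N)).
      by move=> a b ab; have /forallP/(_ b)/implyP/(_ ab) := sP a.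
    have := iota_ltn_sorted 0 k.
    by rewrite -val_enum_ord sorted_map.
  - by move=> x; rewrite mem_enum; apply/imsetP/codomP => [[i' _ ->]|[i' ->]]; exists i'.
apply/ffunP => i; rewrite ffunE.
rewrite (nth_map i) ?size_enum_ord ?ltn_ord //.
by congr (s _); apply/val_inj; rewrite /= nth_enum_ord.
Qed.

Definition sminus k (s : {ffun 'I_k -> 'I_n.+1}) p : {ffun 'I_k.-1 -> 'I_n.+1} :=
  incr k.-1 (img s :\ p).
Definition splus k (s : {ffun 'I_k -> 'I_n.+1}) q : {ffun 'I_k.+1 -> 'I_n.+1} :=
  incr k.+1 (q |: img s).

(* The length l of the complement is an argument, so that no cast is needed
   where n.+1 - k is expected in the form (n - k).+1; only l = n + 1 - k is
   meaningful. *)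
Definition compl l k (s : {ffun 'I_k -> 'I_n.+1}) : {ffun 'I_l -> 'I_n.+1} :=
  incr l (~: img s).

Definition fcat k l (s : {ffun 'I_k -> 'I_n.+1}) (t : {ffun 'I_l -> 'I_n.+1}) :
    {ffun 'I_(k + l) -> 'I_n.+1} :=
  [ffun i : 'I_(k + l) => match fintype.split i with inl j => s j | inr j => t j end].

(* The sign of the permutation sorting the sequence f; the default value is only
   reached when f has repeated entries. *)
Definition sort_sign (F : pzRingType) k (f : {ffun 'I_k -> 'I_n.+1}) : F :=
  if [pick s : 'S_k | [ffun i : 'I_k => f (s i)] \in incmaps k n] is Some s
  then (-1) ^+ s else 0.

Definition eps (F : pzRingType) k l
    (s : {ffun 'I_k -> 'I_n.+1}) (t : {ffun 'I_l -> 'I_n.+1}) : F :=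
  sort_sign F (fcat s t).
Definition eps1 (F : pzRingType) l q (t : {ffun 'I_l -> 'I_n.+1}) : F :=
  eps F [ffun _ : 'I_1 => q] t.

End Indices.

Arguments sort_sign {n F k}.
Arguments eps {n F k l}.
Arguments eps1 {n F l}.

Local Open Scope classical_set_scope.
Local Open Scope complex_scope.

Section LebesgueTuple.
Variable R : realType.
Local Notation RT := (measurableTypeR R).

Definition tcons n (z : RT * n.-tuple RT) : n.+1.-tuple RT := [tuple of z.1 :: z.2].

Lemma measurable_tcons n : measurable_fun [set: RT * n.-tuple RT] (@tcons n).
Proof. by apply: measurable_cons. Qed.

Section Step.
Variables (n : nat) (mu : {sigma_finite_measure set (n.-tuple RT) -> \bar R}).

Definition lebesgue_step : set (n.+1.-tuple RT) -> \bar R :=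
  pushforward (@lebesgue_measure R \x mu)%E (@tcons n).

Let step0 : lebesgue_step set0 = 0%E.
Proof. by rewrite /lebesgue_step /pushforward preimage_set0 measure0. Qed.

Let step_ge0 A : (0 <= lebesgue_step A)%E.
Proof. exact: (@measure_ge0 _ _ _ (@lebesgue_measure R \x mu)%E). Qed.

Let step_sigma_additive : semi_sigma_additive lebesgue_step.
Proof.
have mt A : measurable A -> measurable (@tcons n @^-1` A).
  by move=> mA; rewrite -[X in measurable X]setTI; exact: measurable_tcons.
move=> F mF tF mUF; rewrite /lebesgue_step /pushforward preimage_bigcup.
apply: measure_semi_sigma_additive.
- by move=> i; exact: mt.
- apply/trivIsetP => /= i j _ _ ij; rewrite -preimage_setI.
  by move/trivIsetP : tF => /(_ _ _ _ _ ij) -> //; rewrite preimage_set0.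
- by rewrite -preimage_bigcup; exact: mt.
Qed.

HB.instance Definition _ := isMeasure.Build _ _ _
  lebesgue_step step0 step_ge0 step_sigma_additive.

Lemma lebesgue_step_sigma_finite : sigma_finite setT lebesgue_step.
Proof.
have /sigma_finiteP[F [TF ndF Foo]] := sigma_finiteT (@lebesgue_measure R).
have /sigma_finiteP[G [TG ndG Goo]] := sigma_finiteT mu.
have FT : setT = \bigcup_i (F i `*` G i).
  rewrite -setXTT TF TG predeqE => -[x y]; split.
    move=> [/= [i _ Fix] [k _ Gky]]; exists (maxn i k) => //; split.
    - by move: x Fix; exact/subsetPset/ndF/leq_maxl.
    - by move: y Gky; exact/subsetPset/ndG/leq_maxr.
  by move=> [i _ []/= ? ?]; split; exists i.
pose unc (t : n.+1.-tuple RT) : RT * n.-tuple RT := (thead t, [tuple of behead t]).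
have uncK z : unc (tcons z) = z.
  by case: z => x t; congr pair; apply/val_inj.
exists (fun i => unc @^-1` (F i `*` G i)).
  by rewrite -preimage_bigcup -FT preimage_setT.
move=> i; have [mF fF] := Foo i; have [mG fG] := Goo i; split.
  rewrite -[X in measurable X]setTI.
  have : measurable_fun setT unc.
    apply/measurable_fun_pairP; split.
      exact: (@measurable_tnth _ RT n.+1 ord0).
    exact: measurable_behead.
  by apply => //; exact: measurableX.
rewrite /lebesgue_step /pushforward.
suff -> : @tcons n @^-1` (unc @^-1` (F i `*` G i)) = F i `*` G i.
  by rewrite product_measure1E// lte_mul_pinfty// ge0_fin_numE.
by apply/seteqP; split => z zF; [rewrite -(uncK z)|
  have : (F i `*` G i) (unc (tcons z)) by rewrite uncK].
Qed.

HB.instance Definition _ :=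
  Measure_isSigmaFinite.Build _ _ _ lebesgue_step lebesgue_step_sigma_finite.

End Step.

(* The n-fold product of the Lebesgue measure on the line. *)
Fixpoint lebesgue_tuple n : {sigma_finite_measure set (n.-tuple RT) -> \bar R} :=
  match n with
  | 0 => [the {sigma_finite_measure set (0.-tuple RT) -> \bar R} of
            dirac ([tuple] : 0.-tuple RT)]
  | n'.+1 => [the {sigma_finite_measure set (n'.+1.-tuple RT) -> \bar R} of
            lebesgue_step (lebesgue_tuple n')]
  end.

End LebesgueTuple.

(* The n-simplex spanned by the vertices, in R^m. The orientation of the simplex
   is given relative to the one defined by the order of the vertices, from which
   it differs when [reversed] is true. *)
Record simplex (R : realType) (m n : nat) := Simplex {
  vertex : 'I_n.+1 -> 'rV[R]_m;
  reversed : bool;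
  affinely_independent :
    row_free (\matrix_(i < n) (vertex (lift ord0 i) - vertex ord0))
}.

Section Forms.
Variables (R : realType) (m n : nat) (T : simplex R m n).
Local Notation C := R[i].
Local Notation RT := (measurableTypeR R).

Definition edges : 'M[R]_(n, m) :=
  \matrix_(i < n) (vertex T (lift ord0 i) - vertex T ord0).

Definition simplex_set : set 'rV[R]_m :=
  [set x | exists w : 'I_n.+1 -> R,
     [/\ forall i, 0 <= w i, \sum_i w i = 1 & x = \sum_i w i *: vertex T i]].

(* An affine extension to R^m of the i-th barycentric coordinate of T, see
   [bary_affine] and [bary_vertex]; only its restriction to the affine hull of T
   matters. *)
Definition bary (i : 'I_n.+1) (x : 'rV[R]_m) : R :=
  let y := (x - vertex T ord0) *m pinvmx edges in
  if unlift ord0 i is Some j then y 0 j else 1 - \sum_j y 0 j.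

Lemma bary_affine i (t : R) x y :
  bary i ((1 - t) *: x + t *: y) = (1 - t) * bary i x + t * bary i y.
Proof.
have E : ((1 - t) *: x + t *: y - vertex T ord0) *m pinvmx edges =
    (1 - t) *: ((x - vertex T ord0) *m pinvmx edges) +
    t *: ((y - vertex T ord0) *m pinvmx edges).
  rewrite !scalemxAl -mulmxDl; congr (_ *m _).
  rewrite !scalerBr addrACA -opprD -scalerDl subrK scale1r //.
rewrite /bary E; move: ((x - _) *m _) ((y - _) *m _) => u w.
case: unliftP => [j|] _; first by rewrite !mxE.
under eq_bigr do rewrite !mxE.
by rewrite big_split /= -!mulr_sumr !mulrBr !mulr1 opprD addrACA subrK.
Qed.

Lemma bary_vertex i j : bary i (vertex T j) = (i == j)%:R.
Proof.
have vE k : (vertex T (lift ord0 k) - vertex T ord0) *m pinvmx edges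
    = delta_mx 0 k.
  have -> : vertex T (lift ord0 k) - vertex T ord0 = row k edges.
    by rewrite /edges rowK.
  rewrite -row_mul mulmxVp; last exact: (affinely_independent T).
  by rewrite row1.
rewrite /bary; case: (unliftP ord0 j) => [k|] ->.
  rewrite vE; case: unliftP => [l|] ->; rewrite ?mxE.
    by rewrite (inj_eq lift_inj).
  rewrite (bigD1 k) //= big1 => [|l /negbTE lk]; rewrite !mxE ?lk ?andbF //.
  by rewrite !eqxx addr0 subrr.
rewrite subrr mul0mx; case: unliftP => [l|] ->; rewrite ?mxE.
  by [].
by rewrite big1 => [|l _]; rewrite ?mxE // subr0 eqxx.
Qed.

Lemma sum_bary x : \sum_i bary i x = 1.
Proof.
rewrite big_ord_recl /bary unlift_none.
by under [X in _ + X]eq_bigr do rewrite liftK; rewrite subrK.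
Qed.

(* A differential d-form on T, represented by a function of a point of R^m and
   of d vectors of R^m, the rows of a matrix. Only the values at points of T and
   at vectors tangent to T, i.e., in the row space of [edges], are meaningful. *)
Definition dform (d : nat) := 'rV[R]_m -> 'M[R]_(d, m) -> C.

HB.instance Definition _ d := GRing.Zmodule.on (dform d).

Definition form_eq d (a b : dform d) : Prop :=
  forall x U, simplex_set x -> (U <= edges)%MS -> a x U = b x U.

Definition form_scale d (f : 'rV[R]_m -> C) (a : dform d) : dform d :=
  fun x U => f x * a x U.

Definition form_cast d e (de : d = e) (a : dform d) : dform e :=
  fun x U => a x (castmx (esym de, erefl m) U).

(* (a /\ b)(u_1,..,u_(d+e)) is the sum of
   sgn(s) a(u_s(1),..,u_s(d)) b(u_s(d+1),..,u_s(d+e)) / (d! e!)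
   over all permutations s. *)
Definition wedge d e (a : dform d) (b : dform e) : dform (d + e) :=
  fun x U => (d`! * e`!)%:R^-1 *
    \sum_(s : 'S_(d + e)) (-1) ^+ s *
       (a x (usubmx (row_perm s U)) * b x (dsubmx (row_perm s U))).

Fixpoint wedge_big d : ('I_d -> dform 1) -> dform d :=
  match d with
  | 0 => fun _ _ _ => 1
  | d'.+1 => fun a => wedge (a ord0) (wedge_big (fun i => a (lift ord0 i)))
  end.

Definition dbary (i : 'I_n.+1) : dform 1 :=
  fun x U => ('D_(row 0 U) (bary i) x)%:C.

Definition dlambda d (s : {ffun 'I_d -> 'I_n.+1}) : dform d :=
  wedge_big (fun i => dbary (s i)).

Definition lambda (i : 'I_n.+1) (x : 'rV[R]_m) : C := (bary i x)%:C.

Definition lambda_pow (a : {ffun 'I_n.+1 -> nat}) (x : 'rV[R]_m) : C :=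
  \prod_i lambda i x ^+ a i.

Definition lambda_prod d (s : {ffun 'I_d -> 'I_n.+1}) (x : 'rV[R]_m) : C :=
  \prod_i lambda (s i) x.

Definition whitney d (s : {ffun 'I_d.+1 -> 'I_n.+1}) : dform d :=
  \sum_(p in img s)
     form_scale (fun x => eps1 p (sminus s p) * lambda p x) (dlambda (sminus s p)).

Definition whitneyT : dform n := whitney [ffun i : 'I_n.+1 => i].

Definition refsimplex : set (n.-tuple RT) :=
  [set y | (forall i, 0 <= tnth y i) /\ \sum_(i < n) tnth y i <= 1].

Definition chart (y : n.-tuple RT) : 'rV[R]_m :=
  vertex T ord0 + (\row_i tnth y i) *m edges.

(* The integral of the pullback of a by [chart], which is positively oriented
   with respect to the order of the vertices and has the rows of [edges] as
   partial derivatives. *)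
Definition form_integral (a : dform n) : C :=
  (-1) ^+ reversed T *
  ((\int[lebesgue_tuple R n]_(y in refsimplex) complex.Re (a (chart y) edges)) +i*
   (\int[lebesgue_tuple R n]_(y in refsimplex) complex.Im (a (chart y) edges))).

End Forms.

Arguments form_scale {R m d}.
Arguments wedge {R m d e}.
Arguments dlambda {R m n} T {d}.
Arguments lambda_prod {R m n} T {d}.
Arguments whitney {R m n} T {d}.

(* Main.v *)
Require Import Defs.
From mathcomp Require Import all_boot all_order all_algebra all_fingroup.
From mathcomp Require Import ring.
From mathcomp Require Import reals complex.
Set Implicit Arguments.
Unset Strict Implicit.
Unset Printing Implicit Defensive.
Import Order.TTheory GRing.Theory Num.Theory.
Local Open Scope ring_scope.

(** Fix a point x of T. Put u_A = sum_a omega_(a,A) lambda^a for a set A of k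
    indices, and let S = lambda /\ u be the exterior product of the vector
    lambda = (lambda_0, .., lambda_n) with the element u of the exterior algebra on
    the indices; explicitly, S_B = sum_(p in B) +- lambda_p u_(B - p), which is also
    the polynomial under the square in the identity.

    The identity holds pointwise. Expanding the Whitney forms, the sum of the forms
    eps(s, s^c) u_s phi_(s^c) is (-1)^k sum_B +- S_B dlambda_(B^c)
    ([whitney_formE]). Its conjugate is then paired with the sum of the forms
    u_s lambda_(s^c) dlambda_s. On the edges of T, the wedge product of dlambda_A
    and dlambda_(B^c) is a determinant, which vanishes unless A = B - q and is then
    a sign; hence this pairing rebuilds S_B, and the result is the sum over B of
    lambda_(B^c) |S_B|^2 ([pairing_form_edges]). For the signs, the sign of the
    permutation sorting two increasing sequences is a product of factors indexed by
    the pairs of their entries ([eps_shuffle]), hence multiplicative in each of the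
    two sets.

    The integrands on the right are nonnegative, so that the integrals vanish only
    if the polynomials S_B vanish in the interior of T ([koszul_eq0]). As the
    monomials in the barycentric coordinates of a given degree are independent, this
    means that the coefficients of the S_B, which are the Koszul relations
    [koszul], are 0. Conversely, if S = 0 then the form with coefficients
    eps(s, s^c) u_s is 0 by the expansion above. The other form is 0 as well: the
    lambda_i sum to 1, so that contraction with (1, .., 1) is a homotopy
    ([ext_mul_exact]) and u = lambda /\ v for some v; this factors the sum of the
    dlambda_i, which is 0, out of the form. Each of the two forms is a factor of the
    pairing, which therefore vanishes with either of them.

    That all the Koszul relations follow from those for which the least index of the
    monomial precedes the complement of B is a consequence of
    lambda /\ lambda /\ u = 0 ([koszul_koszul], [koszul_reduction]). *)

(** * Signs of shuffles *)

Section OrderSign.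
Variable F : numDomainType.

Definition sg (i j : nat) : F := if (i < j)%N then 1 else if (j < i)%N then -1 else 0.

Lemma sgC i j : sg j i = - sg i j.
Proof. by rewrite /sg; case: ltngtP => _; rewrite ?opprK ?oppr0. Qed.

Lemma sgii i : sg i i = 0.
Proof. by rewrite /sg ltnn. Qed.

Lemma sg_sqr i j : i != j -> sg i j ^+ 2 = 1.
Proof. by rewrite /sg; case: ltngtP => // _ _; rewrite ?expr1n ?sqrrN ?expr1n. Qed.

Lemma sgE i j : j%:R - i%:R = sg i j * `|j%:R - i%:R| :> F.
Proof.
rewrite /sg; case: ltngtP => [ij|ji|->]; last by rewrite subrr mul0r.
  by rewrite mul1r ger0_norm // subr_ge0 ler_nat ltnW.
by rewrite distrC ger0_norm ?mulN1r ?opprB // subr_ge0 ler_nat ltnW.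
Qed.

Definition seq_sign N (f : 'I_N -> nat) : F :=
  \prod_(i < N) \prod_(j < N | (i < j)%N) sg (f i) (f j).

(** Permuting the columns of a Vandermonde matrix multiplies its determinant by the
    sign of the permutation, while the determinant is the product of the
    differences of the nodes; comparing signs in this product gives the inversion
    formula. *)
Lemma seq_sign_perm N (s : 'S_N) : seq_sign (fun i => s i) = (-1) ^+ s.
Proof.
pose V (t : 'S_N) : F := \prod_(i < N) \prod_(j < N | (i < j)%N) ((t j)%:R - (t i)%:R).
have VE t : V t = (-1) ^+ t * V 1%g.
  pose a (u : 'S_N) : 'rV[F]_N := \row_i (u i)%:R.
  have Va u : V u = \det (Vandermonde N (a u)).
    rewrite det_Vandermonde; apply: eq_bigr => i _; apply: eq_bigr => j _.
    by rewrite !mxE.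
  rewrite !Va.
  have -> : Vandermonde N (a t) = col_perm t (Vandermonde N (a 1%g)).
    by apply/matrixP => i j; rewrite !mxE perm1.
  by rewrite col_permE det_mulmx det_perm odd_permV mulrC.
have V1 : V 1%g != 0.
  apply/prodf_neq0 => i _; apply/prodf_neq0 => j ij; rewrite !perm1 subr_eq0.
  by rewrite eqr_nat gtn_eqF.
have Vs t : V t = seq_sign (fun i => t i) * `|V t|.
  rewrite /V normr_prod -big_split; apply: eq_bigr => i _ /=.
  by rewrite normr_prod -big_split; apply: eq_bigr => j _ /=; rewrite -sgE.
have V1p : `|V 1%g| = V 1%g.
  rewrite ger0_norm //; apply: prodr_ge0 => i _; apply: prodr_ge0 => j ij.
  by rewrite !perm1 subr_ge0 ler_nat ltnW.
apply: (mulIf V1); rewrite -VE [RHS]Vs (VE s) normrM normrX normrN1 expr1n mul1r.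
by rewrite V1p.
Qed.

End OrderSign.

Section SortSign.
Variables (F : numDomainType) (n : nat).
Implicit Types A B : {set 'I_n.+1}.

Lemma incmaps_ltn k (s : {ffun 'I_k -> 'I_n.+1}) (i j : 'I_k) :
  s \in incmaps k n -> (i < j)%N -> (s i < s j)%N.
Proof. by rewrite inE => /forallP/(_ i)/forallP/(_ j)/implyP. Qed.

Lemma incmaps_sg k (s : {ffun 'I_k -> 'I_n.+1}) (i j : 'I_k) :
  s \in incmaps k n -> sg F (s i) (s j) = sg F i j.
Proof.
move=> sP; rewrite /sg; case: (ltngtP i j) => [ij|ij|/val_inj ->].
- by rewrite incmaps_ltn.
- by have h := incmaps_ltn sP ij; rewrite ltnNge (ltnW h) h.
- by rewrite ltnn.
Qed.

Lemma card_img k (s : {ffun 'I_k -> 'I_n.+1}) : injective s -> #|img s| = k.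
Proof. by move=> sI; rewrite card_imset // card_ord. Qed.

Lemma card_incmaps k (s : {ffun 'I_k -> 'I_n.+1}) : s \in incmaps k n -> #|img s| = k.
Proof. by move/incmaps_inj/card_img. Qed.

Lemma sorting_perm k (f : {ffun 'I_k -> 'I_n.+1}) : injective f ->
  exists s : 'S_k, [ffun i => f (s i)] = incr k (img f).
Proof.
move=> fI; have fk := card_img fI.
have gI := incmaps_inj (incr_incmaps fk).
have ex i : {j | f j == incr k (img f) i}.
  apply: sigW.
  have : incr k (img f) i \in img (incr k (img f)) by exact: imset_f.
  by rewrite img_incr // => /imsetP[j _ ->]; exists j.
have hI : injective (fun i => sval (ex i)).
  by move=> i j /(congr1 f); rewrite !(eqP (svalP (ex _))) => /gI.
exists (perm hI); apply/ffunP => i; rewrite ffunE permE.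
exact: (eqP (svalP (ex i))).
Qed.

Lemma seq_sign_repeat k (f : 'I_k -> 'I_n.+1) :
  ~ injective f -> seq_sign F (fun i => f i) = 0.
Proof.
move=> nf; have /injectivePn[i [j ij fij]] : ~~ injectiveb f by apply/injectiveP.
apply/eqP; wlog lij : i j ij fij / (i < j)%N.
  by move=> H; case: (ltngtP i j) => [|ji|/val_inj/eqP]; [exact: H|
    apply: (H j i) => //; rewrite eq_sym|rewrite (negbTE ij)].
apply/prodf_eq0; exists i => //; apply/prodf_eq0; exists j => //.
by rewrite fij sgii.
Qed.

Lemma sort_signE k (f : {ffun 'I_k -> 'I_n.+1}) :
  sort_sign f = seq_sign F (fun i => f i).
Proof.
rewrite /sort_sign; case: pickP => [s sP|ns].
  rewrite -odd_permV -(seq_sign_perm F).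
  apply: eq_bigr => i _; apply: eq_bigr => j _.
  have {1}-> : f i = [ffun i => f (s i)] (s^-1%g i) by rewrite ffunE permKV.
  have {1}-> : f j = [ffun i => f (s i)] (s^-1%g j) by rewrite ffunE permKV.
  by rewrite incmaps_sg.
have [fI|/negP nf] := boolP (injectiveb f).
  have [s sE] := sorting_perm (injectiveP _ fI).
  by have := ns s; rewrite sE incr_incmaps // card_img //; exact/injectiveP.
by rewrite seq_sign_repeat // => /injectiveP.
Qed.

(** For disjoint sets, the sign of sorting the elements of [A] followed by those of
    [B]; otherwise 0. As it is multiplicative in each argument, it turns all
    manipulations of signs below into commutative algebra. *)
Definition shuffle A B : F := \prod_(i in A) \prod_(j in B) sg F i j.

Lemma prod_img k (s : {ffun 'I_k -> 'I_n.+1}) (h : 'I_n.+1 -> F) : injective s ->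
  \prod_(i in img s) h i = \prod_i h (s i).
Proof. by move=> sI; rewrite big_imset //; move=> ? ? _ _; exact: sI. Qed.

Lemma seq_sign_inc k (s : {ffun 'I_k -> 'I_n.+1}) : s \in incmaps k n ->
  seq_sign F (fun i => s i) = 1.
Proof.
move=> sP; apply: big1 => i _; apply: big1 => j ij.
by rewrite incmaps_sg // /sg ij.
Qed.

Lemma seq_sign_fcat k l (s : {ffun 'I_k -> 'I_n.+1}) (t : {ffun 'I_l -> 'I_n.+1}) :
  seq_sign F (fun i => fcat s t i) =
  seq_sign F (fun i => s i) * seq_sign F (fun i => t i) *
  \prod_i \prod_j sg F (s i) (t j).
Proof.
rewrite /seq_sign big_split_ord /= mulrAC -big_split /=; congr (_ * _).
  apply: eq_bigr => i _; rewrite big_split_ord /=; congr (_ * _).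
    by apply: eq_big => // j _; rewrite !ffunE !(unsplitK (inl _)).
  apply: eq_big => [j|j _]; first by rewrite ltn_addr.
  by rewrite !ffunE (unsplitK (inl i)) (unsplitK (inr j)).
apply: eq_bigr => i _; rewrite big_split_ord /= big1 ?mul1r => [|j]; last first.
  by rewrite ltnNge ltnW // ltn_addr.
apply: eq_big => [j|j _]; first by rewrite ltn_add2l.
by rewrite !ffunE !(unsplitK (inr _)).
Qed.

Lemma eps_shuffle k l (s : {ffun 'I_k -> 'I_n.+1}) (t : {ffun 'I_l -> 'I_n.+1}) :
  s \in incmaps k n -> t \in incmaps l n -> eps s t = shuffle (img s) (img t).
Proof.
move=> sP tP; rewrite /eps sort_signE seq_sign_fcat !seq_sign_inc // !mul1r.
rewrite /shuffle prod_img; last exact: incmaps_inj.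
by apply: eq_bigr => i _; rewrite prod_img //; exact: incmaps_inj.
Qed.

Lemma const1_incmaps (q : 'I_n.+1) : [ffun _ : 'I_1 => q] \in incmaps 1 n.
Proof. by rewrite inE; apply/forallP => i; apply/forallP => j; rewrite !ord1. Qed.

Lemma img_const1 (q : 'I_n.+1) : img [ffun _ : 'I_1 => q] = [set q].
Proof.
apply/setP => x; rewrite inE; apply/imsetP/eqP => [[i _ ->]|->]; first by rewrite ffunE.
by exists ord0; rewrite ?ffunE.
Qed.

Lemma eps1_shuffle l q (t : {ffun 'I_l -> 'I_n.+1}) :
  t \in incmaps l n -> eps1 q t = shuffle [set q] (img t).
Proof. by move=> tP; rewrite /eps1 eps_shuffle ?const1_incmaps // img_const1. Qed.

Lemma prod_setU A B (h : 'I_n.+1 -> F) : [disjoint A & B] ->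
  \prod_(i in A :|: B) h i = \prod_(i in A) h i * \prod_(i in B) h i.
Proof. by move=> AB; rewrite -bigU //; apply: eq_bigl => i; rewrite !inE. Qed.

Lemma shuffleUl A B D : [disjoint A & B] ->
  shuffle (A :|: B) D = shuffle A D * shuffle B D.
Proof. by move=> AB; rewrite /shuffle prod_setU. Qed.

Lemma shuffleUr A B D : [disjoint A & B] ->
  shuffle D (A :|: B) = shuffle D A * shuffle D B.
Proof.
move=> AB; rewrite /shuffle -big_split; apply: eq_bigr => i _ /=.
by rewrite prod_setU.
Qed.

Lemma shuffle0 A B : ~~ [disjoint A & B] -> shuffle A B = 0.
Proof.
rewrite -setI_eq0 => /set0Pn[i /setIP[iA iB]].
by apply/eqP/prodf_eq0; exists i => //; apply/prodf_eq0; exists i => //; rewrite sgii.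
Qed.

Lemma shuffle_sqr A B : [disjoint A & B] -> shuffle A B ^+ 2 = 1.
Proof.
move=> AB; rewrite /shuffle -prodrXl; apply: big1 => i iA.
rewrite -prodrXl; apply: big1 => j jB; apply: sg_sqr.
by apply/eqP => /val_inj ij; move: jB; rewrite -ij (disjointFr AB).
Qed.

Lemma shuffleC A B : shuffle A B = (-1) ^+ (#|A| * #|B|) * shuffle B A.
Proof.
rewrite {2}/shuffle exchange_big /= /shuffle.
under [LHS]eq_bigr do under eq_bigr do rewrite sgC.
under [LHS]eq_bigr do rewrite prodrN.
by rewrite big_split /= prodr_const -exprM mulnC.
Qed.

End SortSign.

(** * Determinants *)

Section Determinants.
Variable F : comNzRingType.

Lemma block_perm_subproof d e (s : 'S_d) (t : 'S_e) :
  injective (fun i : 'I_(d + e) => match fintype.split i with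
    | inl a => lshift e (s a) | inr b => rshift d (t b) end).
Proof.
move=> i j; case: (fintype.splitP i) => a ia; case: (fintype.splitP j) => b jb.
- by move=> /lshift_inj/perm_inj ab; apply/val_inj; rewrite /= ia jb ab.
- by move=> /eqP; rewrite eq_lrshift.
- by move=> /eqP; rewrite eq_rlshift.
- by move=> /rshift_inj/perm_inj ab; apply/val_inj; rewrite /= ia jb ab.
Qed.

Definition block_perm d e (s : 'S_d) (t : 'S_e) : 'S_(d + e) :=
  perm (@block_perm_subproof d e s t).

Lemma block_perml d e (s : 'S_d) (t : 'S_e) i :
  block_perm s t (lshift e i) = lshift e (s i).
Proof. by rewrite permE (unsplitK (inl i)). Qed.

Lemma block_permr d e (s : 'S_d) (t : 'S_e) i :
  block_perm s t (rshift d i) = rshift d (t i).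
Proof. by rewrite permE (unsplitK (inr i)). Qed.

Lemma block_perm_sign d e (s : 'S_d) (t : 'S_e) :
  (-1) ^+ block_perm s t = (-1) ^+ s * (-1) ^+ t :> F.
Proof.
rewrite -!det_perm -(det_ublock _ (0 : 'M_(d, e))); congr (\det _).
apply/matrixP => i j; rewrite /block_mx !mxE.
case: (fintype.splitP i) => a ia.
  have -> : i = lshift e a by apply/val_inj.
  rewrite block_perml !mxE; case: (fintype.splitP j) => b jb.
    have -> : j = lshift e b by apply/val_inj.
    by rewrite !mxE eq_lshift.
  have -> : j = rshift d b by apply/val_inj.
  by rewrite !mxE eq_lrshift.
have -> : i = rshift d a by apply/val_inj.
rewrite block_permr !mxE; case: (fintype.splitP j) => b jb.
  have -> : j = lshift e b by apply/val_inj.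
  by rewrite !mxE eq_rlshift.
have -> : j = rshift d b by apply/val_inj.
by rewrite !mxE eq_rshift.
Qed.

(** Averaged Laplace expansion: grouping the terms by the permutation they give
    rise to, each pair of permutations of the two blocks contributes one copy of
    the determinant. *)
Lemma det_shuffle_blocks d e (M : 'M[F]_(d + e)) :
  \sum_(s : 'S_(d + e)) (-1) ^+ s *
    (\det (ulsubmx (col_perm s M)) * \det (drsubmx (col_perm s M)))
  = (d`! * e`!)%:R * \det M.
Proof.
have E (s : 'S_(d + e)) : (-1) ^+ s *
    (\det (ulsubmx (col_perm s M)) * \det (drsubmx (col_perm s M)))
    = \sum_(u : 'S_d) \sum_(v : 'S_e) (-1) ^+ (block_perm u v * s)%g *
       \prod_i M i ((block_perm u v * s)%g i).
  rewrite /determinant big_distrlr mulr_sumr /=; apply: eq_bigr => u _.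
  rewrite mulr_sumr; apply: eq_bigr => v _.
  rewrite odd_permM signr_addb block_perm_sign big_split_ord /=.
  rewrite !mulrA [_ * (-1) ^+ s]mulrC !mulrA -!mulrA; do 2!congr (_ * _).
  rewrite mulrCA; congr (_ * _).
  by congr (_ * _); apply: eq_bigr => i _;
     rewrite !mxE permM ?block_perml ?block_permr.
rewrite (eq_bigr _ (fun s _ => E s)) exchange_big /=.
under eq_bigr => u _.
  rewrite exchange_big /=.
  under eq_bigr => v _.
    rewrite -(reindex_inj (mulgI (block_perm u v))
      (P := xpredT) (F := fun t : 'S_(d + e) => (-1) ^+ t * \prod_i M i (t i))).
    over.
  rewrite sumr_const.
  over.
by rewrite sumr_const !card_Sn -mulrnA mulnC [RHS]mulr_natl.
Qed.

(** Linearity in the first row. It is used for covectors that sum to 0, and for the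
    basis vectors, which sum to a row of ones. *)
Lemma det_sum_row0 (I : finType) d (v : I -> 'I_d.+1 -> F) (w : 'I_d -> 'I_d.+1 -> F) :
  \sum_q \det (\matrix_(i, j) (if unlift ord0 i is Some a then w a j else v q j))
  = \det (\matrix_(i, j)
      (if unlift ord0 i is Some a then w a j else \sum_q v q j)).
Proof.
rewrite [RHS](expand_det_row _ ord0).
under eq_bigr do rewrite (expand_det_row _ ord0).
rewrite exchange_big /=; apply: eq_bigr => j _.
rewrite !mxE unlift_none mulr_suml; apply: eq_bigr => q _.
rewrite !mxE unlift_none /cofactor; congr (_ * (_ * \det _)).
by apply/matrixP => a b; rewrite !mxE liftK.
Qed.

Lemma det_repeat d (I : eqType) (f : 'I_d -> I) (G : I -> 'I_d -> F) :
  ~ injective f -> \det (\matrix_(i, j) G (f i) j) = 0.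
Proof.
move=> nf; have /injectivePn[i [j ij fij]] : ~~ injectiveb f by apply/injectiveP.
by apply: (determinant_alternate ij) => a; rewrite !mxE fij.
Qed.

End Determinants.

Section SignedRows.
Variables (F : numDomainType) (n : nat).

Lemma det_sort_rows d (f : {ffun 'I_d -> 'I_n.+1}) (G : 'I_n.+1 -> 'I_d -> F) :
  \det (\matrix_(i, j) G (f i) j) =
  seq_sign F (fun i => f i) * \det (\matrix_(i, j) G (incr d (img f) i) j).
Proof.
have [/injectiveP fI|/injectiveP nf] := boolP (injectiveb f).
  have [s sE] := sorting_perm fI.
  have fE i : f i = incr d (img f) (s^-1%g i) by rewrite -sE ffunE permKV.
  have sP := incr_incmaps (card_img fI).
  have -> : (\matrix_(i, j) G (f i) j) =
      row_perm s^-1%g (\matrix_(i, j) G (incr d (img f) i) j).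
    by apply/matrixP => i j; rewrite !mxE -fE.
  rewrite row_permE det_mulmx det_perm -(seq_sign_perm F); congr (_ * _).
  by apply: eq_bigr => i _; apply: eq_bigr => j _; rewrite !fE incmaps_sg.
by rewrite det_repeat // seq_sign_repeat // mul0r.
Qed.

Lemma incr_setT : incr n.+1 [set: 'I_n.+1] = [ffun i => i].
Proof.
apply/ffunP => i; rewrite !ffunE enum_setT -enumT.
by apply/val_inj; rewrite /= nth_enum_ord.
Qed.

Lemma det_select (f : {ffun 'I_n.+1 -> 'I_n.+1}) :
  \det (\matrix_(i, j) (f i == j)%:R) = seq_sign F (fun i => f i).
Proof.
have [/injectiveP fI|/injectiveP nf] := boolP (injectiveb f).
  rewrite (det_sort_rows f (fun i j => (i == j)%:R)).
  have -> : img f = setT.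
    by apply/eqP; rewrite eqEcard subsetT card_img // cardsT card_ord leqnn.
  rewrite incr_setT [X in _ * \det X](_ : _ = 1%:M) ?det1 ?mulr1 //.
  by apply/matrixP => i j; rewrite !mxE ffunE.
by rewrite (det_repeat (fun i j => (i == j)%:R)) // seq_sign_repeat.
Qed.

End SignedRows.

(** * The exterior algebra on the indices *)

Section SetSums.
Variables (F : numDomainType) (n : nat).
Implicit Types (A B : {set 'I_n.+1}) (p q : 'I_n.+1).
Local Notation E := (shuffle F).

Lemma sum_incmaps k (h : {ffun 'I_k -> 'I_n.+1} -> F) :
  \sum_(s in incmaps k n) h s = \sum_(A : {set 'I_n.+1} | #|A| == k) h (incr k A).
Proof.
rewrite (reindex_onto (incr k) (@img n k)); last by move=> s; exact: incr_img.
apply: eq_bigl => A; apply/andP/eqP => [[sP /eqP <-]|Ak].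
  exact: card_incmaps.
by rewrite incr_incmaps // img_incr.
Qed.

Lemma sum_flags k (h : {set 'I_n.+1} -> 'I_n.+1 -> F) :
  \sum_(A : {set 'I_n.+1} | #|A| == k) \sum_(p | p \notin A) h A p
  = \sum_(B : {set 'I_n.+1} | #|B| == k.+1) \sum_(p in B) h (B :\ p) p.
Proof.
rewrite !pair_big_dep /=.
rewrite (reindex_onto (fun u => (u.1 :\ u.2, u.2)) (fun u => (u.2 |: u.1, u.2))) /=.
  apply: eq_bigl => -[A p] /=; rewrite setD11 /= andbT.
  apply/andP/andP => [[/eqP Ak /eqP[AE]]|[Ak pA]].
    have pA : p \in A by rewrite -AE setU11.
    by rewrite pA (cardsD1 p) pA Ak.
  by rewrite setD1K // eqxx; move: Ak; rewrite (cardsD1 p) pA add1n eqSS.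
by move=> [A p] /= /andP[_ pA]; rewrite setU1K.
Qed.

Lemma shuffle1C p q : E [set p] [set q] = - E [set q] [set p].
Proof. by rewrite shuffleC !cards1 mulN1r. Qed.

Lemma shuffle1_split p q A : p \in A ->
  E [set q] A = E [set q] [set p] * E [set q] (A :\ p).
Proof. by move=> pA; rewrite -{1}(setD1K pA) shuffleUr // disjoints1 setD11. Qed.

Lemma disj_setC A : [disjoint A & ~: A].
Proof. by rewrite disjoints_subset setCK. Qed.

Lemma disj_D1 p A : [disjoint [set p] & A :\ p].
Proof. by rewrite disjoints1 setD11. Qed.

Lemma shuffle1_sqr p A : p \notin A -> E [set p] A ^+ 2 = 1.
Proof. by move=> pA; rewrite shuffle_sqr // disjoints1. Qed.

Lemma shuffle_splitC p A : p \in A ->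
  E A (~: A) = E [set p] (~: A) * E (A :\ p) (~: A).
Proof. by move=> pA; rewrite -{1}(setD1K pA) shuffleUl // disj_D1. Qed.

Lemma setC_D1 p A : ~: (A :\ p) = p |: ~: A.
Proof. by rewrite setDE setCI setCK setUC. Qed.

(** Left multiplication by the vector with coordinates [l], on the exterior algebra
    with basis indexed by the sets of indices. *)
Definition ext_mul (l : 'I_n.+1 -> F) (u : {set 'I_n.+1} -> F) A : F :=
  \sum_(p in A) E [set p] (A :\ p) * l p * u (A :\ p).

Variables (l : 'I_n.+1 -> F) (u : {set 'I_n.+1} -> F).
Local Notation S := (ext_mul l u).

Definition compl_prod A : F := \prod_(i in ~: A) l i.

Lemma compl_prod_D1 p A : p \in A -> compl_prod (A :\ p) = l p * compl_prod A.
Proof.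
by move=> pA; rewrite /compl_prod setC_D1 big_setU1 // inE negbK.
Qed.

(** Expanding the Whitney forms of the complements and collecting the terms by
    B = A + p produces the exterior product. The sign (-1)^k is the cost of moving
    p across the k elements of A. *)
Lemma whitney_expansion k (D : {set 'I_n.+1} -> F) :
  \sum_(A : {set 'I_n.+1} | #|A| == k) E A (~: A) * u A *
     \sum_(p in ~: A) E [set p] (~: A :\ p) * l p * D (~: A :\ p)
  = (-1) ^+ k *
    \sum_(B : {set 'I_n.+1} | #|B| == k.+1) E B (~: B) * S B * D (~: B).
Proof.
under eq_bigr do rewrite mulr_sumr.
under eq_bigr do under eq_bigl do rewrite inE.
rewrite sum_flags mulr_sumr; apply: eq_bigr => B /eqP Bk.
rewrite mulrAC !mulr_sumr; apply: eq_bigr => p pB.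
have pC : p \notin ~: B by rewrite inE negbK.
rewrite setC_D1 setU1K // shuffleUr ?disjoints1 //.
rewrite [E _ [set p]]shuffleC cards1 muln1 (shuffle_splitC pB).
have -> : #|B :\ p| = k by move: Bk; rewrite (cardsD1 p) pB => -[].
ring.
Qed.

(** The hypothesis on [W] is the value of a wedge product of basis forms of
    complementary degrees. The summands with A not contained in B vanish, and those
    with A = B - q recombine, by multiplicativity of the signs, to the exterior
    product. *)
Lemma sum_pairing k (W : {set 'I_n.+1} -> {set 'I_n.+1} -> F) B : #|B| = k.+1 ->
  (forall A, #|A| = k -> W A (~: B) =
     \sum_q E [set q] A * E [set q] (~: B) * E A (~: B)) ->
  \sum_(A : {set 'I_n.+1} | #|A| == k) u A * compl_prod A * W A (~: B)
  = E B (~: B) * compl_prod B * S B.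
Proof.
move=> Bk WE.
transitivity (\sum_(A : {set 'I_n.+1} | #|A| == k) \sum_(q | q \notin A)
    u A * compl_prod A * (E [set q] A * E [set q] (~: B) * E A (~: B))).
  apply: eq_bigr => A /eqP Ak; rewrite WE // mulr_sumr [RHS]big_mkcond /=.
  apply: eq_bigr => q _; case: ifPn => // /negPn qA.
  by rewrite shuffle0 ?mul0r ?mulr0 // disjoints1 negbK.
rewrite sum_flags (bigD1 B) ?Bk //= [X in _ + X]big1 ?addr0; last first.
  move=> B' /andP[/eqP B'k nB]; apply: big1 => q qB'.
  have BB' : ~~ [disjoint B' & ~: B].
    rewrite disjoints_subset setCK; apply: contra nB => sB.
    by rewrite eqEcard sB Bk B'k leqnn.
  have := shuffle0 F BB'; rewrite -{1}(setD1K qB') shuffleUl ?disj_D1 // => e0.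
  by rewrite -!mulrA e0 !mulr0.
rewrite mulr_sumr; apply: eq_bigr => q qB.
rewrite compl_prod_D1 // (shuffle_splitC qB).
ring.
Qed.

(** Contraction with (1,..,1) is a homotopy for [ext_mul l] as the entries of
    [l] sum to 1: the kernel of [ext_mul l] consists of multiples of [l]. *)
Lemma ext_mul_exact k A : \sum_i l i = 1 ->
  (forall B, #|B| = k.+1 -> S B = 0) -> #|A| = k ->
  u A = ext_mul l (fun B => \sum_(p | p \notin B) E [set p] B * u (p |: B)) A.
Proof.
move=> l1 S0 Ak.
have SA : \sum_(p | p \notin A) E [set p] A * S (p |: A) = 0.
  by apply: big1 => p pA; rewrite S0 ?mulr0 // cardsU1 pA Ak.
rewrite (bigID (mem A)) /= in l1.
transitivity (u A * (\sum_(i in A) l i + \sum_(i | i \notin A) l i) -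
    \sum_(p | p \notin A) E [set p] A * S (p |: A)).
  by rewrite SA l1 mulr1 subr0.
rewrite /ext_mul.
have E1 (q : 'I_n.+1) : q \in A -> E [set q] (A :\ q) * l q *
      (\sum_(p | p \notin A :\ q) E [set p] (A :\ q) * u (p |: A :\ q))
    = u A * l q + \sum_(p | p \notin A)
        E [set q] (A :\ q) * l q * (E [set p] (A :\ q) * u (p |: A :\ q)).
  move=> qA; rewrite (bigD1 q) ?setD11 //= mulrDr; congr (_ + _).
    rewrite setD1K //.
    have := @shuffle1_sqr q (A :\ q); rewrite setD11 => /(_ isT) e2.
    by rewrite -[RHS]mulr1 -e2; ring.
  rewrite mulr_sumr; apply: eq_bigl => p; rewrite !inE negb_and negbK.
  by case: eqP => [->|]; rewrite ?qA //= andbT.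
rewrite [RHS](eq_bigr _ E1) {E1} big_split /= mulrDr mulr_sumr -addrA; congr (_ + _).
rewrite exchange_big mulr_sumr -sumrB /=; apply: eq_bigr => p pA.
rewrite (bigD1 p) ?setU11 //= setU1K // mulrDr opprD addrA.
rewrite (_ : u A * l p - _ = 0) ?add0r; last first.
  by rewrite -[u A * l p]mul1r -(shuffle1_sqr pA); ring.
rewrite mulr_sumr -sumrN; apply: eq_big => [q|q].
  by rewrite !inE; case: eqP => [->|]; rewrite ?(negbTE pA) //= andbT.
rewrite !inE => /andP[/orP[/eqP->|qA]]; rewrite ?eqxx // => qp.
have -> : (p |: A) :\ q = p |: A :\ q.
  by apply/setP => i; rewrite !inE; case: (i =P p) => [->|//]; rewrite eq_sym qp.
have pAq : p \notin A :\ q by rewrite !inE (negbTE pA) andbF.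
rewrite shuffleUr ?disjoints1 // (shuffle1_split p qA) shuffle1C.
have := shuffle_sqr F (_ : [disjoint [set q] & [set p]]).
rewrite disjoints1 inE qp => /(_ isT) e2.
rewrite -[RHS]mul1r -e2.
ring.
Qed.

(** Writing the kernel element [u] as a multiple of [l] turns the sum into one over
    the sets of size k - 1, with inner sums that vanish by the relation between the
    values of [D]. For basis forms this relation is that the differentials of the
    barycentric coordinates sum to 0. *)
Lemma sum_kernel_eq0 k (D : {set 'I_n.+1} -> F) : \sum_i l i = 1 ->
  (forall A, #|A|.+1 = k -> \sum_(q | q \notin A) E [set q] A * D (q |: A) = 0) ->
  (forall B, #|B| = k.+1 -> S B = 0) ->
  \sum_(A : {set 'I_n.+1} | #|A| == k) u A * compl_prod A * D A = 0.
Proof.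
move=> l1 D0 S0.
set v := fun B => \sum_(p | p \notin B) E [set p] B * u (p |: B).
transitivity (\sum_(A : {set 'I_n.+1} | #|A| == k) \sum_(p in A)
    v (A :\ p) * compl_prod (A :\ p) * (E [set p] (A :\ p) * D (p |: A :\ p))).
  apply: eq_bigr => A /eqP Ak; rewrite (ext_mul_exact l1 S0 Ak) /ext_mul !mulr_suml.
  by apply: eq_bigr => p pA; rewrite setD1K // compl_prod_D1 // /v; ring.
case: k D0 {S0} => [_|k D0].
  by apply: big1 => A /eqP/cards0_eq ->; rewrite big_set0.
rewrite -(sum_flags k (fun A p => v A * compl_prod A * (E [set p] A * D (p |: A)))).
apply: big1 => A /eqP Ak.
by rewrite -mulr_sumr D0 ?mulr0 // Ak.
Qed.

End SetSums.

(** * Independence of the monomials of a given degree *)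

Section Monomials.

Lemma digits_inj N n (b c : nat -> nat) :
  (forall i, b i < N)%N -> (forall i, c i < N)%N ->
  (\sum_(i < n) b i * N ^ i = \sum_(i < n) c i * N ^ i)%N ->
  forall i, (i < n)%N -> b i = c i.
Proof.
elim: n b c => // n IH b c bN cN.
have shift (d : nat -> nat) :
    (\sum_(i < n.+1) d i * N ^ i = d 0 + (\sum_(i < n) d i.+1 * N ^ i) * N)%N.
  rewrite big_ord_recl expn0 muln1; congr (_ + _)%N.
  by rewrite big_distrl; apply: eq_bigr => i _; rewrite /= /bump add1n expnSr mulnA.
rewrite !shift => e.
have e0 : b 0 = c 0.
  have := congr1 (fun x => x %% N)%N e.
  by rewrite -![(_ + _ * N)%N]addnC !modnMDl !modn_small.
have N0 : (0 < N)%N by exact: leq_ltn_trans (bN 0).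
move: e; rewrite e0 => /addnI/eqP; rewrite eqn_pmul2r // => /eqP es.
by case=> // i; rewrite ltnS; apply: (IH (fun i => b i.+1) (fun i => c i.+1)).
Qed.

Variables (F : numFieldType) (n r : nat).

(** The Kronecker substitution sends the i-th variable to the (r+1)^i-th power of a
    single one; it separates the monomials of degree r. *)
Lemma monomials_free (c : {ffun 'I_n.+1 -> nat} -> F) :
  (forall w : 'I_n.+1 -> F, (forall i, 0 < w i) -> \sum_i w i = 1 ->
     \sum_(b <- multis r n) c b * \prod_i w i ^+ b i = 0) ->
  forall b, b \in multis r n -> c b = 0.
Proof.
move=> c0; pose e (b : {ffun 'I_n.+1 -> nat}) := (\sum_i b i * r.+1 ^ i)%N.
(* by homogeneity, the sum of the variables need not be 1 *)
have hom (w : 'I_n.+1 -> F) : (forall i, 0 < w i) ->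
    \sum_(b <- multis r n) c b * \prod_i w i ^+ b i = 0.
  move=> w0; pose s := \sum_i w i.
  have s0 : s != 0.
    rewrite gt_eqF // /s big_ord_recl; apply: ltr_wpDr => //.
    by apply: sumr_ge0 => i _; exact: ltW.
  have sp : 0 < s by rewrite lt_def s0 sumr_ge0 // => i _; exact: ltW.
  have := c0 (fun i => w i / s).
  rewrite -mulr_suml divff // => /(_ _ erefl).
  have E : \sum_(b <- multis r n) c b * \prod_i (w i / s) ^+ b i =
      (s ^+ r)^-1 * \sum_(b <- multis r n) c b * \prod_i w i ^+ b i.
    rewrite mulr_sumr; apply: eq_big_seq => b.
    rewrite mem_multis => /eqP br; rewrite mulrCA; congr (_ * _).
    under eq_bigr do rewrite exprMn exprVn.
    by rewrite big_split /= mulrC prodfV -expr_sum br.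
  rewrite E => /(_ _)/eqP; rewrite mulf_eq0 invr_eq0 expf_eq0 (negbTE s0) andbF /=.
  by move=> H; apply/eqP/H => i; exact: divr_gt0.
pose p : {poly F} := \sum_(b <- multis r n) c b *: 'X^(e b).
have p0 : p = 0.
  apply/eqP/negPn/negP => pn0.
  have := max_poly_roots pn0 (rs := [seq k.+1%:R | k <- iota 0 (size p)]).
  rewrite size_map size_iota ltnn => H; suff : false by [].
  apply: H.
    apply/allP => _ /mapP[k _ ->]; apply/rootP; rewrite horner_sum.
    rewrite -[RHS](hom (fun i => k.+1%:R ^+ (r.+1 ^ i))); last first.
      by move=> i; rewrite exprn_gt0 // ltr0n.
    apply: eq_bigr => b _; rewrite hornerZ hornerXn; congr (_ * _).
    by rewrite expr_sum; apply: eq_bigr => i _; rewrite -exprM mulnC.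
  rewrite map_inj_uniq ?iota_uniq // => i j /eqP.
  by rewrite eqr_nat eqSS => /eqP.
have bound b : b \in multis r n -> forall i, (b i < r.+1)%N.
  by rewrite mem_multis => /eqP <- i; rewrite ltnS (bigD1 i) //= leq_addr.
have e_inj : {in multis r n &, injective e}.
  move=> b b' br b'r ee; apply/ffunP => i.
  have := @digits_inj r.+1 n.+1 (fun i => b (inord i)) (fun i => b' (inord i))
    _ _ _ i (ltn_ord i).
  rewrite inord_val; apply => [j|j|]; try exact: bound.
  by move: ee; rewrite /e => ee; under eq_bigr do rewrite inord_val;
    under [RHS]eq_bigr do rewrite inord_val.
move=> b br; have := congr1 (fun q : {poly F} => q`_(e b)) p0.
rewrite coef_sum coef0 (bigD1_seq b) ?multis_uniq //= coefZ coefXn eqxx mulr1.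
rewrite big_seq_cond big1 ?addr0 // => b' /andP[b'r bb'].
rewrite coefZ coefXn; case: eqP => [ee|]; last by rewrite mulr0.
by rewrite (e_inj _ _ br b'r ee) eqxx in bb'.
Qed.

End Monomials.

From mathcomp Require Import all_classical all_reals all_analysis measurable_realfun.
Import numFieldNormedType.Exports.
Local Open Scope complex_scope.

(** * The Koszul relations between the coefficients *)

Section MultiIndices.
Variable n : nat.
Implicit Types (a b : {ffun 'I_n.+1 -> nat}) (p q : 'I_n.+1) (A B : {set 'I_n.+1}).

Lemma maddK a p : msub (madd a p) p = a.
Proof. by apply/ffunP => i; rewrite !ffunE addnK. Qed.

Lemma msubK b p : p \in msupp b -> madd (msub b p) p = b.
Proof.
rewrite inE => bp; apply/ffunP => i; rewrite !ffunE.
by case: eqP => [->|_]; rewrite ?subnK ?subn0 ?addn0.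
Qed.

Lemma msubA b p q : msub (msub b p) q = msub (msub b q) p.
Proof. by apply/ffunP => i; rewrite !ffunE subnAC. Qed.

Lemma mem_madd r a p : (madd a p \in multis r.+1 n) = (a \in multis r n).
Proof.
rewrite !mem_multis; under eq_bigr do rewrite ffunE.
rewrite big_split /= [X in (_ + X)%N](_ : _ = 1)%N ?addn1 ?eqSS //.
by rewrite (bigD1 p) //= eqxx big1 // => i /negbTE ->.
Qed.

Lemma mem_msub r b p : p \in msupp b -> b \in multis r.+1 n ->
  msub b p \in multis r n.
Proof. by move=> bp; rewrite -(mem_madd r _ p) msubK. Qed.

Lemma madd_supp a p : p \in msupp (madd a p).
Proof. by rewrite inE ffunE eqxx addn1. Qed.

Lemma sum_multis_madd (V : nmodType) r p (h : {ffun 'I_n.+1 -> nat} -> V) :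
  \sum_(b <- multis r.+1 n | p \in msupp b) h b = \sum_(a <- multis r n) h (madd a p).
Proof.
rewrite -big_filter -(big_map (fun a => madd a p) xpredT h); apply: perm_big.
apply: uniq_perm; rewrite ?filter_uniq ?multis_uniq //.
  by rewrite map_inj_uniq ?multis_uniq // => a b ab; rewrite -(maddK a p) ab maddK.
move=> b; rewrite mem_filter; apply/andP/mapP => [[pb br]|[a ar ->]].
  by exists (msub b p); rewrite ?mem_msub ?msubK.
by rewrite madd_supp mem_madd.
Qed.

Lemma set_min_le A i : i \in A -> (set_min A <= i)%N.
Proof.
move=> iA; rewrite /set_min.
have : i \in index_enum 'I_n.+1 by rewrite mem_index_enum.
elim: (index_enum _) => // j s IH; rewrite inE big_cons => /orP[/eqP <-|/IH sl].
  by rewrite iA geq_minl.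
by case: ifP => // _; rewrite (leq_trans (geq_minr _ _)).
Qed.

Lemma le_set_min A (c : nat) : (c <= n.+1)%N ->
  (forall i, i \in A -> (c <= i)%N) -> (c <= set_min A)%N.
Proof.
move=> cn cA; rewrite /set_min.
by elim/big_rec: _ => // i x /cA ci cx; rewrite leq_min ci.
Qed.

Lemma set_min_eq A f : f \in A -> (forall i, i \in A -> (f <= i)%N) -> set_min A = f.
Proof.
move=> fA fm; apply/eqP; rewrite eqn_leq set_min_le //= le_set_min //.
exact: ltnW.
Qed.

Lemma set_minP A : A != finset.set0 ->
  exists f, [/\ f \in A, set_min A = f & forall i, i \in A -> (f <= i)%N].
Proof.
case/finset.set0Pn => i0 i0A; case: (arg_minnP (@nat_of_ord n.+1) i0A) => f fA fm.
by exists f; split => //; exact: set_min_eq.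
Qed.

End MultiIndices.

Section Koszul.
Variables (F : numDomainType) (n : nat).
Variable om : {ffun 'I_n.+1 -> nat} -> {set 'I_n.+1} -> F.
Implicit Types (a b : {ffun 'I_n.+1 -> nat}) (p q f : 'I_n.+1) (A B : {set 'I_n.+1}).
Local Notation E := (shuffle F).

(** The coefficient of the monomial b, at the basis element B, of the exterior
    product by the vector of coordinates of a form with polynomial coefficients. *)
Definition koszul b B : F :=
  \sum_(p in B :&: msupp b) E [set p] (B :\ p) * om (msub b p) (B :\ p).

Lemma setD1A A p q : A :\ p :\ q = A :\ q :\ p.
Proof. by apply/setP => i; rewrite !inE andbCA. Qed.

Lemma setU1D1 A p q : p != q -> (p |: A) :\ q = p |: A :\ q.
Proof.
move=> pq; apply/setP => i; rewrite !inE.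
by case: (i =P p) => [->|//]; rewrite pq.
Qed.

End Koszul.

(** The two orders of removing a pair of indices contribute opposite terms. *)
Lemma koszul_koszul (F : numDomainType) n (om : {ffun 'I_n.+1 -> nat} -> {set 'I_n.+1} -> F) b B :
  koszul (koszul om) b B = 0.
Proof.
set X := B :&: msupp b.
pose G q p := shuffle F [set q] (B :\ q) * (shuffle F [set p] (B :\ q :\ p)
  * om (msub (msub b q) p) (B :\ q :\ p)).
have -> : koszul (koszul om) b B = \sum_(q in X) \sum_(p in X | p != q) G q p.
  apply: eq_bigr => q _; rewrite mulr_sumr; apply: eq_bigl => p.
  rewrite !inE ffunE; case: eqP => [->|_]; rewrite /= ?andbF // subn0.
  by rewrite andbT.
have GC p q : p \in X -> q \in X -> p != q -> G q p = - G p q.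
  move=> /setIP[pB _] /setIP[qB _] pq; rewrite /G msubA.
  rewrite (@shuffle1_split F n p q (B :\ q)) ?inE ?pq //.
  rewrite (@shuffle1_split F n q p (B :\ p)) ?inE 1?eq_sym ?pq //.
  by rewrite (setD1A B p q) shuffle1C; ring.
set Y := LHS; suff Yn : Y = - Y.
  have : Y *+ 2 == 0 by rewrite mulr2n {2}Yn subrr.
  by rewrite mulrn_eq0 => /eqP.
rewrite {1}/Y (exchange_big_dep (mem X)) /=; last by move=> ? ? _ /andP[].
rewrite /Y -sumrN; apply: eq_bigr => p pX; rewrite -sumrN.
apply: eq_big => [q|q /andP[qX]]; first by rewrite pX eq_sym.
by case/andP=> _; exact: GC.
Qed.

Section Reduction.
Variables (F : numDomainType) (n k r : nat).
Variable om : {ffun 'I_n.+1 -> nat} -> {set 'I_n.+1} -> F.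
Implicit Types (a b : {ffun 'I_n.+1 -> nat}) (p q f : 'I_n.+1) (A B : {set 'I_n.+1}).
Local Notation E := (shuffle F).

(** As f is the least index of the support of the multi-index, it precedes every q
    of the sum, which accounts for the minus sign. *)
Lemma koszul_madd a A f : f \notin A -> (forall i, i \in msupp a -> (f <= i)%N) ->
  koszul om (madd a f) (f |: A) = E [set f] A *
    (om a A - \sum_(q in A :&: msupp a)
       E [set f] A * E [set q] (A :\ q) * om (msub (madd a f) q) ((f |: A) :\ q)).
Proof.
move=> fA fm; rewrite /koszul.
have -> : (f |: A) :&: msupp (madd a f) = f |: (A :&: msupp a).
  apply/setP => i; rewrite !inE ffunE; case: eqP => [->|_] /=; first by rewrite addn1.
  by rewrite addn0.
rewrite finset.big_setU1 ?inE ?(negbTE fA) //= finset.setU1K // maddK mulrBr; congr (_ + _).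
rewrite mulr_sumr -sumrN; apply: eq_bigr => q /setIP[qA qa].
have fq : f != q by apply: contraNneq fA => ->.
have fAq : f \notin A :\ q by rewrite !inE (negbTE fA) andbF.
rewrite setU1D1 // shuffleUr ?disjoints1 //.
have -> : E [set q] [set f] = -1.
  rewrite /shuffle !big_set1 /sg; have := fm q qa; rewrite leq_eqVlt.
  by rewrite (inj_eq val_inj) (negbTE fq) /= => fltq; rewrite fltq ltnNge ltnW.
have := shuffle1_sqr F fA => e2.
rewrite mulN1r -[LHS]mul1r -e2.
ring.
Qed.

(** By [koszul_madd], the relations on the right are those for the pairs (b, B) such
    that the least index of b belongs to B and precedes the complement of B. They
    imply the others: if f, the least index outside B, is at most the least index
    of b, then all the terms but one of [koszul_koszul] at (b + f, B + f) are given
    by relations of this kind, and the remaining one is the relation for (b, B). *)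
Lemma koszul_reduction : (k <= n)%N ->
  (forall b B, b \in multis r.+1 n -> #|B| = k.+1 -> koszul om b B = 0) <->
  (forall a A, a \in multis r n -> #|A| = k ->
    (set_min (~: A) <= set_min (msupp a))%N ->
    let f : 'I_n.+1 := inord (set_min (~: A)) in
    om a A - \sum_(q in A :&: msupp a)
      E [set f] A * E [set q] (A :\ q) * om (msub (madd a f) q) ((f |: A) :\ q) = 0).
Proof.
move=> kn; split=> [K a A ar Ak /= fle|c].
  have [|f [fA fE fm]] := @set_minP n (~: A).
    by rewrite -card_gt0 cardsCs finset.setCK Ak card_ord subn_gt0 ltnS.
  rewrite fE inord_val in fle *.
  have fm' i : i \in msupp a -> (f <= i)%N by move=> ia; exact: leq_trans (set_min_le ia).
  have nfA : f \notin A by rewrite inE in fA.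
  have := K (madd a f) (f |: A); rewrite mem_madd cardsU1 nfA Ak add1n koszul_madd //.
  move=> /(_ ar erefl)/(congr1 ( *%R (E [set f] A))).
  by rewrite mulr0 mulrA -expr2 shuffle1_sqr // mul1r.
(* the relations that are instances of the hypothesis, in terms of b and B *)
have K1 b B f : b \in multis r.+1 n -> #|B| = k.+1 -> f \in B -> f \in msupp b ->
    (forall i, i \in msupp b -> (f <= i)%N) -> (forall i, i \notin B -> (f < i)%N) ->
    koszul om b B = 0.
  move=> br Bk fB fb fm fB'.
  rewrite -(msubK fb) -(finset.setD1K fB).
  have fm' i : i \in msupp (msub b f) -> (f <= i)%N.
    by rewrite inE ffunE => ib; apply: fm; rewrite inE; apply: leq_trans ib (leq_subr _ _).
  have fmin : set_min (~: (B :\ f)) = f.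
    apply: set_min_eq => [|i]; first by rewrite !inE eqxx.
    by rewrite setC_D1 !inE => /orP[/eqP-> //|/fB'/ltnW].
  rewrite koszul_madd ?setD11 //.
  have := c (msub b f) (B :\ f).
  rewrite mem_msub // fmin inord_val => -> //; rewrite ?mulr0 //.
    by move: Bk; rewrite (cardsD1 f) fB => -[].
  by apply: le_set_min => //; exact: ltnW.
move=> b B br Bk.
have [|m [mb _ mm]] := @set_minP n (msupp b).
  apply: contraTneq br => b0; rewrite mem_multis big1 // => i _.
  by have := finset.in_set0 i; rewrite -b0 inE lt0n => /negbFE/eqP.
have [mB|] := boolP [forall i, (i \notin B) ==> (m < i)%N].
  have {}mB i : i \notin B -> (m < i)%N by move/forallP : mB => /(_ i)/implyP.
  apply: (K1 b B m) => //.
  by apply/negPn/negP => /mB; rewrite ltnn.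
rewrite negb_forall => /existsP[i0]; rewrite negb_imply -leqNgt => /andP[i0B i0m].
have [|f [fB _ fm]] := @set_minP n (~: B).
  by apply/finset.set0Pn; exists i0; rewrite inE.
have lefm : (f <= m)%N by apply: leq_trans i0m; apply: fm; rewrite inE.
have nfB : f \notin B by rewrite inE in fB.
have lefb i : i \in msupp b -> (f <= i)%N by move=> ib; exact: leq_trans lefm (mm i ib).
have := koszul_koszul om (madd b f) (f |: B).
rewrite {1}/koszul (bigD1 f) /=; last by rewrite finset.in_setI finset.setU11 madd_supp.
rewrite maddK finset.setU1K // [X in _ + X]big1 => [|q].
  rewrite addr0 => /(congr1 ( *%R (E [set f] B))).
  by rewrite mulr0 mulrA -expr2 shuffle1_sqr // mul1r.
rewrite !inE ffunE => /andP[/andP[/orP[/eqP->|qB] qb] qf]; first by rewrite eqxx in qf.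
rewrite (negbTE qf) addn0 in qb.
have fq : f != q by rewrite eq_sym.
have ltfq : (f < q)%N.
  by rewrite ltn_neqAle (inj_eq val_inj) fq lefb // inE.
rewrite (K1 _ _ f) ?mulr0 //.
- by rewrite mem_msub ?mem_madd // inE ffunE (negbTE qf) addn0.
- have := cardsD1 q (f |: B); rewrite cardsU1 nfB Bk add1n.
  by rewrite finset.in_setU1 qB orbT add1n => -[].
- by rewrite !inE fq eqxx.
- by rewrite inE !ffunE eqxx (negbTE fq) addn1.
- move=> i; rewrite inE !ffunE; case: eqP => [-> //|_] ib; apply: lefb.
  by rewrite inE; apply: leq_trans ib _; rewrite addn0 leq_subr.
- move=> i; rewrite !inE negb_and negbK => /orP[/eqP -> //|].
  rewrite negb_or => /andP[fi iB]; rewrite ltn_neqAle eq_sym (inj_eq val_inj) fi.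
  by apply: fm; rewrite inE.
Qed.

End Reduction.

(** * Evaluation of the basis forms *)

Section Forms.
Variables (R : realType) (m n : nat) (T : simplex R m n).
Local Notation C := R[i].
Implicit Types (x v : 'rV[R]_m).

Lemma dformD d (a b : dform R m d) x U : (a + b) x U = a x U + b x U.
Proof. by []. Qed.

Lemma dform_sumE (I : Type) (r : seq I) (P : pred I) d (h : I -> dform R m d) x U :
  (\sum_(i <- r | P i) h i) x U = \sum_(i <- r | P i) h i x U.
Proof. by apply: (big_morph (fun f : dform R m d => f x U)). Qed.

Definition det_form d (w : 'I_d -> 'rV[R]_m -> C) : dform R m d :=
  fun _ U => \det (\matrix_(i, j) w i (row j U)).

(** The coefficient of the wedge product cancels the number of pairs of permutations
    in the averaged Laplace expansion. *)
Lemma wedge_det d e (w : 'I_d -> 'rV[R]_m -> C) (w' : 'I_e -> 'rV[R]_m -> C) :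
  wedge (det_form w) (det_form w') =
  det_form (fun i => match fintype.split i with inl a => w a | inr b => w' b end).
Proof.
apply/funext => x; apply/funext => U; rewrite /wedge /det_form.
set M := (X in _ = \det X).
have nz : (d`! * e`!)%:R != 0 :> C by rewrite pnatr_eq0 -lt0n muln_gt0 !fact_gt0.
apply: (mulfI nz); rewrite mulVKf // -det_shuffle_blocks.
have El s : (\matrix_(i, j) w i (row j (usubmx (row_perm s U)))) =
    ulsubmx (col_perm s M).
  apply/matrixP => i j; rewrite !mxE (unsplitK (inl i)).
  by congr (w i _); apply/rowP => a; rewrite !mxE.
have Er s : (\matrix_(i, j) w' i (row j (dsubmx (row_perm s U)))) =
    drsubmx (col_perm s M).
  apply/matrixP => i j; rewrite !mxE (unsplitK (inr i)).
  by congr (w' i _); apply/rowP => a; rewrite !mxE.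
by apply: eq_bigr => s _; rewrite El Er.
Qed.

Lemma wedge_big_det d (w : 'I_d -> 'rV[R]_m -> C) :
  wedge_big (fun i _ (U : 'M[R]_(1, m)) => w i (row 0 U)) = det_form w.
Proof.
elim: d w => [|d IH] w.
  by apply/funext => x; apply/funext => U; rewrite /= /det_form det_mx00.
have w0 : (fun _ (U : 'M[R]_(1, m)) => w ord0 (row 0 U)) =
    det_form (fun _ : 'I_1 => w ord0).
  by apply/funext => x; apply/funext => U; rewrite /det_form det_mx11 mxE.
have IHw := IH (fun i => w (lift ord0 i)).
rewrite [LHS](_ : _ = wedge (fun _ (U : 'M[R]_(1, m)) => w ord0 (row 0 U))
  (wedge_big (fun i _ (U : 'M[R]_(1, m)) => w (lift ord0 i) (row 0 U)))) // IHw w0.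
rewrite wedge_det; congr det_form; apply/funext => i.
case: fintype.splitP => a ia; congr w; apply/val_inj => //=.
by rewrite ia ord1.
Qed.

(** The linear part of an affine function. *)
Definition lin_bary (i : 'I_n.+1) v : R := bary T i v - bary T i 0.

Lemma bary_shift i (h : R) x v :
  bary T i (h *: v + x) = h * lin_bary i v + bary T i x.
Proof.
rewrite /lin_bary /bary; set P := pinvmx _; set v0 := vertex T ord0.
have -> : (h *: v + x - v0) *m P =
    h *: ((v - v0) *m P - (0 - v0) *m P) + (x - v0) *m P.
  by rewrite -mulmxBl scalemxAl -mulmxDl sub0r opprK subrK addrA.
move: (_ *m P) (_ *m P) (_ *m P) => a b c.
case: unliftP => [j|] _; first by rewrite !mxE.
under eq_bigr do rewrite !mxE.
by rewrite big_split /= -mulr_sumr sumrB; ring.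
Qed.

Lemma derive_bary i x v : 'D_v (bary T i) x = lin_bary i v.
Proof.
rewrite /derive; apply: cvg_lim => //.
apply: (@cvg_trans _ ((fun=> lin_bary i v) @ (0:R)^')%classic); last exact: cvg_cst.
apply: near_eq_cvg; near=> h.
rewrite /= bary_shift addrK scalerA mulVf ?scale1r //.
by near: h; exact: nbhs_dnbhs_neq.
Unshelve. all: by end_near. Qed.

Lemma dlambdaE d (s : {ffun 'I_d -> 'I_n.+1}) :
  dlambda T s = det_form (fun i v => (lin_bary (s i) v)%:C).
Proof.
rewrite -wedge_big_det /dlambda; congr wedge_big.
by apply/funext => i; apply/funext => x; apply/funext => U; rewrite /dbary derive_bary.
Qed.

Lemma wedge_dlambda d e (s : {ffun 'I_d -> 'I_n.+1}) (t : {ffun 'I_e -> 'I_n.+1}) :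
  wedge (dlambda T s) (dlambda T t) = dlambda T (fcat s t).
Proof.
rewrite !dlambdaE wedge_det; congr det_form; apply/funext => i; rewrite ffunE.
by case: fintype.split.
Qed.

Lemma sum_lin_bary v : \sum_i lin_bary i v = 0.
Proof. by rewrite sumrB !sum_bary subrr. Qed.

Lemma conj_dlambda d (s : {ffun 'I_d -> 'I_n.+1}) x U :
  (dlambda T s x U)^* = dlambda T s x U.
Proof.
rewrite dlambdaE /det_form -det_map_mx; congr (\det _).
by apply/matrixP => i j; rewrite !mxE; exact: conjc_real.
Qed.

Lemma lin_bary_edge (i : 'I_n.+1) (j : 'I_n) :
  lin_bary i (row j (edges T)) = (i == lift ord0 j)%:R - (i == ord0)%:R.
Proof.
have := bary_shift i 1 (vertex T ord0) (row j (edges T)).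
by rewrite scale1r mul1r rowK subrK !bary_vertex => ->; rewrite addrK.
Qed.

(** The value on the edges of T: bordering the matrix of the covectors with a
    row of ones and completing the edges to a basis does not change the
    determinant, and expresses it by the signs of the permutations of the
    vertices that extend [f]. *)
Lemma dlambda_edges (f : {ffun 'I_n -> 'I_n.+1}) x :
  dlambda T f x (edges T) = \sum_q seq_sign C (fun i => fcat [ffun _ : 'I_1 => q] f i).
Proof.
rewrite dlambdaE /det_form.
(* the columns of P are the first vertex and the edges, in barycentric coordinates *)
pose P : 'M[C]_n.+1 :=
  \matrix_(a, j) ((a == j)%:R - ((a == ord0) && (j != ord0))%:R).
have detP : \det P = 1.
  rewrite (expand_det_col _ ord0) (bigD1 ord0) //= big1 => [|i i0]; last first.
    by rewrite mxE (negbTE i0) /= subrr mul0r.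
  rewrite addr0 mxE eqxx subr0 mul1r /cofactor expr0 mul1r -(det1 _ n).
  congr determinant; apply/matrixP => i j.
  by rewrite !mxE subr0 (inj_eq lift_inj).
pose M : 'M[C]_n.+1 := \matrix_(i, j)
  (if unlift ord0 i is Some a then (f a == j)%:R else \sum_(q < n.+1) (q == j)%:R).
have MP : \det (M *m P) = \det (\matrix_(i < n, j < n)
    (lin_bary (f i) (row j (edges T)))%:C).
  have delta (c : 'I_n.+1) j : \sum_a (c == a)%:R * P a j = P c j.
    rewrite (bigD1 c) //= eqxx mul1r big1 ?addr0 // => a ac.
    by rewrite eq_sym (negbTE ac) mul0r.
  rewrite (expand_det_row _ ord0) (bigD1 ord0) //= big1 => [|j j0]; last first.
    rewrite [X in X * _](_ : _ = 0) ?mul0r // mxE.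
    under eq_bigr do rewrite mxE unlift_none mulr_suml.
    rewrite exchange_big /=; under eq_bigr do rewrite delta.
    under eq_bigr do rewrite mxE j0 andbT.
    rewrite sumrB (bigD1 j) //= eqxx big1 ?addr0; last by move=> i /negbTE ->.
    by rewrite (bigD1 ord0) //= big1 ?addr0 ?subrr // => i /negbTE ->.
  rewrite addr0 [X in X * _](_ : _ = 1) ?mul1r; last first.
    rewrite mxE; under eq_bigr do rewrite mxE unlift_none mulr_suml.
    rewrite exchange_big /=; under eq_bigr do rewrite delta.
    under eq_bigr do rewrite mxE andbF subr0.
    by rewrite (bigD1 ord0) //= big1 ?addr0 // => i /negbTE ->.
  rewrite /cofactor expr0 mul1r; congr determinant; apply/matrixP => i j.
  rewrite !mxE; under eq_bigr do rewrite mxE liftK.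
  rewrite delta mxE lin_bary_edge andbT rmorphB /= !rmorph_nat.
  by [].
rewrite -MP det_mulmx detP mulr1 -det_sum_row0; apply: eq_bigr => q _.
rewrite -det_select; congr determinant; apply/matrixP => i j; rewrite !mxE.
case: (unliftP ord0 i) => [a|] ->.
  have -> : lift ord0 a = rshift 1 a by apply/val_inj.
  by rewrite ffunE (unsplitK (inr a)).
have -> : ord0 = lshift n (ord0 : 'I_1) :> 'I_n.+1 by apply/val_inj.
by rewrite ffunE (unsplitK (inl _)) ffunE.
Qed.

End Forms.

Section FormsOnSets.
Variables (R : realType) (m n : nat) (T : simplex R m n).
Local Notation C := R[i].
Local Notation E := (shuffle C).
Local Notation D d A := (dlambda T (incr d A)).
Implicit Types (A B : {set 'I_n.+1}).

Lemma dlambda_cast_edges d (e : d = n) (f : {ffun 'I_d -> 'I_n.+1}) x :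
  form_cast e (dlambda T f) x (edges T) =
  \sum_q seq_sign C (fun i => fcat [ffun _ : 'I_1 => q] f i).
Proof. by subst d; rewrite /form_cast castmx_id dlambda_edges. Qed.

Lemma seq_sign_cons d (s : {ffun 'I_d -> 'I_n.+1}) q :
  seq_sign C (fun i => fcat [ffun _ : 'I_1 => q] s i) =
  seq_sign C (fun i => s i) * \prod_j sg C q (s j).
Proof.
rewrite seq_sign_fcat seq_sign_inc ?const1_incmaps // mul1r; congr (_ * _).
by rewrite big_ord1; under eq_bigr do rewrite ffunE.
Qed.

Lemma prod_incr d A (h : 'I_n.+1 -> C) : #|A| = d ->
  \prod_j h (incr d A j) = \prod_(i in A) h i.
Proof.
move=> Ad; rewrite -[in RHS](img_incr Ad) prod_img //.
exact: incmaps_inj (incr_incmaps Ad).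
Qed.

Lemma prod_sg (q : 'I_n.+1) A : \prod_(i in A) sg C q i = E [set q] A.
Proof. by rewrite /shuffle big_set1. Qed.

(** Nonzero only when A and B are disjoint: then q is the index that they miss. *)
Lemma wedge_edges k l (e : (k + l)%N = n) A B x : #|A| = k -> #|B| = l ->
  form_cast e (wedge (D k A) (D l B)) x (edges T) =
  \sum_q E [set q] A * E [set q] B * E A B.
Proof.
move=> Ak Bl; rewrite wedge_dlambda dlambda_cast_edges; apply: eq_bigr => q _.
have sP := incr_incmaps Ak; have tP := incr_incmaps Bl.
rewrite seq_sign_cons -sort_signE -/(eps _ _) eps_shuffle // !img_incr // mulrC.
congr (_ * _); rewrite big_split_ord /=.
under eq_bigr do rewrite ffunE (unsplitK (inl _)).
under [X in _ * X]eq_bigr do rewrite ffunE (unsplitK (inr _)).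
by rewrite !(prod_incr (fun i => sg C q i)) // !prod_sg.
Qed.

Lemma whitney_set l B x U : #|B| = l.+1 ->
  whitney T (incr l.+1 B) x U =
  \sum_(p in B) E [set p] (B :\ p) * lambda T p x * D l (B :\ p) x U.
Proof.
move=> Bl; rewrite /whitney dform_sumE img_incr //; apply: eq_bigr => p pB.
have Bp : #|B :\ p| = l by move: Bl; rewrite (cardsD1 p) pB => -[].
rewrite /form_scale /sminus img_incr //= eps1_shuffle ?incr_incmaps //.
by rewrite img_incr.
Qed.

Lemma conj_shuffle A B : (E A B)^* = E A B.
Proof.
rewrite /shuffle rmorph_prod; apply: eq_bigr => i _.
rewrite rmorph_prod; apply: eq_bigr => j _.
by rewrite /sg; case: ifP => _; [|case: ifP => _];
  rewrite ?rmorphN ?rmorph1 ?rmorph0.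
Qed.

Lemma conj_whitney l B x U : #|B| = l.+1 ->
  (whitney T (incr l.+1 B) x U)^* = whitney T (incr l.+1 B) x U.
Proof.
move=> Bl; rewrite whitney_set // rmorph_sum; apply: eq_bigr => p _.
rewrite !rmorphM; congr (_ * _ * _); last exact: conj_dlambda.
  exact: conj_shuffle.
exact: conjc_real.
Qed.

Lemma sum_lambda x : \sum_i lambda T i x = 1.
Proof. by rewrite /lambda -rmorph_sum sum_bary. Qed.

(** Each summand contributes its barycentric coordinate, and these sum to 1. *)
Lemma whitneyT_edges x : whitneyT T x (edges T) = 1.
Proof.
rewrite /whitneyT -incr_setT whitney_set ?cardsT ?card_ord //.
rewrite -(sum_lambda x) big_mkcond /=; apply: eq_bigr => p _; rewrite finset.in_setT.
have cp : #|[set: 'I_n.+1] :\ p| = n.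
  by have := cardsD1 p [set: 'I_n.+1]; rewrite finset.in_setT cardsT card_ord => -[].
rewrite dlambda_edges (bigD1 p) //= big1 ?addr0 => [|q qp].
  rewrite seq_sign_cons seq_sign_inc ?incr_incmaps // mul1r.
  rewrite (prod_incr (fun i => sg C p i)) // prod_sg mulrAC -expr2.
  by rewrite shuffle_sqr ?mul1r // disjoints1 setD11.
rewrite seq_sign_cons (prod_incr (fun i => sg C q i)) //.
by rewrite (bigD1 q) /= ?sgii ?mul0r ?mulr0 // !inE qp.
Qed.

(** The sum of the wedge products of the differentials of all the barycentric
    coordinates with a basis form is 0, because they sum to 0. *)
Lemma sum_wedge1_dlambda d A x U : #|A| = d ->
  \sum_(q | q \notin A) E [set q] A * D d.+1 (q |: A) x U = 0.
Proof.
move=> Ad; have sP := incr_incmaps Ad.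
pose f q := fcat [ffun _ : 'I_1 => q] (incr d A).
have imgf q : img (f q) = q |: A.
  apply/setP => i; rewrite finset.in_setU1; apply/imsetP/orP.
    case=> j _ ->; rewrite ffunE; case: fintype.splitP => a _.
      by left; rewrite ffunE.
    have : incr d A a \in img (incr d A) by exact: imset_f.
    by rewrite img_incr // => aA; right.
  case=> [/eqP ->|]; first by exists (lshift d ord0); rewrite // ffunE (unsplitK (inl _)) ffunE.
  rewrite -{1}(img_incr Ad) => /imsetP[a _ ->].
  by exists (rshift 1 a) => //; rewrite [RHS]ffunE (unsplitK (inr _)).
have fE q : \det (\matrix_(i, j) (lin_bary T (f q i) (row j U))%:C) =
    E [set q] A * D d.+1 (q |: A) x U.
  rewrite (det_sort_rows (f q) (fun i j => (lin_bary T i (row j U))%:C)).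
  rewrite imgf dlambdaE; congr (_ * _).
  rewrite seq_sign_cons seq_sign_inc // mul1r (prod_incr (fun i => sg C q i)) //.
  by rewrite prod_sg.
transitivity (\sum_q E [set q] A * D d.+1 (q |: A) x U).
  rewrite big_mkcond; apply: eq_bigr => q _; case: ifPn => // /negPn qA.
  by rewrite shuffle0 ?mul0r // disjoints1 negbK.
under eq_bigr do rewrite -fE.
transitivity (\sum_q \det (\matrix_(i, j < d.+1) (if unlift ord0 i is Some a
   then (lin_bary T (incr d A a) (row j U))%:C else (lin_bary T q (row j U))%:C))).
  apply: eq_bigr => q _; congr determinant; apply/matrixP => i j; rewrite !mxE.
  case: (unliftP ord0 i) => [a|] ->.
    have -> : lift ord0 a = rshift 1 a by apply/val_inj.
    by rewrite [f q _]ffunE (unsplitK (inr a)).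
  have -> : ord0 = lshift d (ord0 : 'I_1) :> 'I_d.+1 by apply/val_inj.
  by rewrite ffunE (unsplitK (inl _)) ffunE.
rewrite (det_sum_row0 (fun q j => (lin_bary T q (row j U))%:C)
  (fun a j => (lin_bary T (incr d A a) (row j U))%:C)).
rewrite (expand_det_row _ ord0) big1 // => j _.
by rewrite mxE unlift_none -rmorph_sum sum_lin_bary mul0r.
Qed.

End FormsOnSets.

(** * Integrals over the reference simplex *)

Section ReferenceSimplex.
Variables (R : realType).
Local Notation RT := (measurableTypeR R).
Local Open Scope classical_set_scope.

Definition tbox n (J : 'I_n -> set RT) : set (n.-tuple RT) :=
  [set y | forall i, J i (tnth y i)].

Lemma tboxE n (J : 'I_n -> set RT) :
  tbox J = \bigcap_(i in [set: 'I_n]) ((fun y : n.-tuple RT => tnth y i) @^-1` J i).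
Proof. by apply/seteqP; split=> [y Jy i _|y Jy i]; [exact: Jy|exact: (Jy i I)]. Qed.

Lemma measurable_tnth_preimage n (i : 'I_n) (A : set RT) : measurable A ->
  measurable ((fun y : n.-tuple RT => tnth y i) @^-1` A).
Proof. by move=> mA; rewrite -[X in measurable X]setTI; exact: (measurable_tnth i). Qed.

Lemma measurable_tbox n (J : 'I_n -> set RT) :
  (forall i, measurable (J i)) -> measurable (tbox J).
Proof.
move=> mJ; rewrite tboxE; apply: fin_bigcap_measurable; first exact: finite_finset.
by move=> i _; exact: measurable_tnth_preimage.
Qed.

Lemma lebesgue_tbox n (J : 'I_n -> set RT) (c : R) :
  (forall i, measurable (J i)) -> (forall i, @lebesgue_measure R (J i) = c%:E) ->
  lebesgue_tuple R n (tbox J) = (c ^+ n)%:E.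
Proof.
elim: n J => [|n IH] J mJ cJ.
  rewrite expr0 /= diracE; suff -> : [tuple] \in tbox J by [].
  by rewrite inE => -[].
rewrite /= /lebesgue_step /pushforward.
have -> : @tcons R n @^-1` tbox J = J ord0 `*` tbox (fun i => J (lift ord0 i)).
  apply/seteqP; split=> -[x t] /=.
    move=> H; split; first exact: (H ord0).
    by move=> i; have := H (lift ord0 i); rewrite tnthS.
  move=> [J0 Jt] i; case: (unliftP ord0 i) => [j|] ->; last by [].
  by rewrite tnthS; exact: Jt.
rewrite product_measure1E //; last by apply: measurable_tbox.
transitivity (c%:E * (c ^+ n)%:E)%E; last by rewrite -EFinM exprS.
by congr (_ * _)%E; [exact: cJ|exact: IH].
Qed.

Variable n : nat.
Local Notation mu := (lebesgue_tuple R n).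
Local Notation Delta := (@refsimplex R n).

Lemma measurable_sum_tnth : measurable_fun [set: n.-tuple RT]
  (fun y : n.-tuple RT => \sum_(i < n) tnth y i : R).
Proof. by apply: measurable_sum => i; exact: measurable_tnth. Qed.

Lemma measurable_refsimplex : measurable Delta.
Proof.
have -> : Delta = tbox (fun=> `[0, +oo[) `&`
    ((fun y : n.-tuple RT => \sum_(i < n) tnth y i : R) @^-1` `]-oo, 1]).
  apply/seteqP; split=> y.
    by move=> [y0 y1]; split => [i|] /=; rewrite in_itv /= ?andbT.
  move=> [/= y0 y1]; split => [i|].
    by have := y0 i; rewrite /= in_itv /= andbT.
  by move: y1; rewrite in_itv.
apply: measurableI; first by apply: measurable_tbox => i; exact: measurable_itv.
by rewrite -[X in measurable X]setTI; apply: measurable_sum_tnth.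
Qed.

Lemma refsimplex_tnth_le1 y i : Delta y -> 0 <= tnth y i <= 1.
Proof.
move=> [y0 y1]; rewrite y0 /=; apply: le_trans y1.
by rewrite (bigD1 i) //= lerDl; apply: sumr_ge0 => j _; exact: y0.
Qed.

Lemma refsimplex_lty : (mu Delta < +oo)%E.
Proof.
apply: (@le_lt_trans _ _ (mu (tbox (fun=> `[0, 1])))).
  apply: le_measure; rewrite ?inE.
  - exact: measurable_refsimplex.
  - by apply: measurable_tbox => i; exact: measurable_itv.
  - by move=> y Dy i; rewrite /= in_itv; exact: refsimplex_tnth_le1.
rewrite (@lebesgue_tbox _ _ 1) ?ltry //.
by move=> i; rewrite lebesgue_measure_itv /= lte_fin ltr01 sube0.
Qed.

(** Functions that are integrable over the reference simplex, and whose nonzero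
    values are detected by integrals. Continuity is that of the function on row
    vectors, for the topology of the maximum norm. *)
Definition tame (f : n.-tuple RT -> R) :=
  [/\ measurable_fun [set: n.-tuple RT] f,
      exists M, forall y, Delta y -> `|f y| <= M &
      continuous (fun x : 'rV[R]_n => f [tuple x 0 i | i < n])].

Lemma tame_cst c : tame (fun=> c).
Proof.
split; [exact: measurable_cst|by exists `|c| |].
exact: cst_continuous.
Qed.

Lemma tame_tnth i : tame (fun y => tnth y i).
Proof.
split; first exact: measurable_tnth.
  by exists 1 => y /(refsimplex_tnth_le1 i)/andP[y0 y1]; rewrite ger0_norm.
move=> x; rewrite (_ : (fun _ => _) = (fun z : 'rV[R]_n => z 0 i)).
  exact: coord_continuous.
by apply/funext => z; rewrite tnth_mktuple.
Qed.

Lemma tameD f g : tame f -> tame g -> tame (fun y => f y + g y).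
Proof.
move=> [mf [M fM] cf] [mg [N gN] cg]; split.
- exact: measurable_funD.
- exists (M + N) => y Dy; apply: le_trans (ler_normD _ _) _.
  by apply: lerD; [exact: fM|exact: gN].
- by move=> x; exact: (cvgD (cf x) (cg x)).
Qed.

Lemma tameM f g : tame f -> tame g -> tame (fun y => f y * g y).
Proof.
move=> [mf [M fM] cf] [mg [N gN] cg]; split.
- exact: measurable_funM.
- exists (M * N) => y Dy; rewrite normrM.
  by apply: ler_pM => //; [exact: fM|exact: gN].
- by move=> x; exact: (cvgM (cf x) (cg x)).
Qed.

Lemma tameN f : tame f -> tame (fun y => - f y).
Proof.
move=> tf; rewrite (_ : (fun y => _) = (fun y => -1 * f y)).
  by apply: tameM => //; exact: tame_cst.
by apply/funext => y; rewrite mulN1r.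
Qed.

Lemma tame_sum (I : Type) (s : seq I) (P : pred I) (f : I -> n.-tuple RT -> R) :
  (forall i, P i -> tame (f i)) -> tame (fun y => \sum_(i <- s | P i) f i y).
Proof.
move=> tf; elim: s => [|i s IH].
  rewrite (_ : (fun y => _) = fun=> 0); first exact: tame_cst.
  by apply/funext => y; rewrite big_nil.
rewrite (_ : (fun y => _) = fun y => (if P i then f i y else 0) +
    \sum_(i <- s | P i) f i y); last first.
  by apply/funext => y; rewrite big_cons; case: ifP; rewrite ?add0r.
by apply: tameD => //; have := tf i; case: (P i) => [tfi|_]; [exact: tfi|exact: tame_cst].
Qed.

Lemma tame_integrable f : tame f -> mu.-integrable Delta (EFin \o f).
Proof.
move=> [mf [M fM] _]; apply: measurable_bounded_integrable.
- exact: measurable_refsimplex.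
- exact: refsimplex_lty.
- exact: measurable_funTS.
- exists M; split; first by rewrite num_real.
  by move=> N MN y Dy; exact: le_trans (fM y Dy) (ltW MN).
Qed.

(** A box around an interior point on which a continuous function stays away from
    0 has positive measure. *)
Lemma tame_integral0 f : tame f -> (forall y, Delta y -> 0 <= f y) ->
  \int[mu]_(y in Delta) f y = 0 ->
  forall y, (forall i, 0 < tnth y i) -> \sum_i tnth y i < 1 -> f y = 0.
Proof.
move=> tf f0 If y y0 y1; apply/eqP/negP => /negP fy.
have mD := measurable_refsimplex.
have [mf _ cf] := tf.
have ae0 : ae_eq mu Delta (EFin \o f) (cst 0%E).
  apply/ae_eq_integral_abs => //; first by apply/measurable_EFinP; exact: measurable_funTS.
  rewrite -(fineK (integrable_fin_num _ (integrable_abse (tame_integrable tf)))) //.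
  rewrite (_ : 0%E = 0%:E) // -[in RHS]If; congr EFin; congr fine.
  by apply: eq_integral => z /set_mem Dz /=; rewrite ger0_norm // f0.
pose x : 'rV[R]_n := \row_i tnth y i.
have tx : [tuple x 0 i | i < n] = y.
  by apply: eq_from_tnth => i; rewrite tnth_mktuple mxE.
(* near x, f does not vanish and the points are in the reference simplex *)
have n0 : \forall z \near x, f [tuple (z : 'rV[R]_n) 0 i | i < n] != 0.
  by apply: (cvgr_neq0 _ (cf x)); rewrite tx.
have nin : \forall z \near x, forall i, 0 < (z : 'rV[R]_n) 0 i.
  have cn i : \forall z \near x, 0 < (z : 'rV[R]_n) 0 i.
    have cx : (fun z : 'rV[R]_n => z 0 i) @ x --> x 0 i by exact: coord_continuous.
    by have := @cvgr_gt _ _ _ (nbhs_filter x) _ _ cx 0; rewrite mxE => /(_ (y0 i)).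
  exact: (@filter_forall _ _ _ _ (nbhs_filter x) cn).
have ns : \forall z \near x, \sum_i (z : 'rV[R]_n) 0 i < 1.
  have [_ _ cs] : tame (fun y => \sum_i tnth y i).
    by apply: tame_sum => i _; exact: tame_tnth.
  have := @cvgr_lt _ _ _ (nbhs_filter x) _ _ (cs x) 1; rewrite tx => /(_ y1).
  apply: filterS => z; under eq_bigr do rewrite tnth_mktuple.
  by [].
have Fx := nbhs_filter x.
have := @filterI _ _ Fx _ _ n0 (@filterI _ _ Fx _ _ nin ns).
rewrite -nbhs_ballE => -[d /= d0 dB].
pose J (i : 'I_n) : set RT := `]tnth y i - d, tnth y i + d[.
have mJ i : measurable (J i) by exact: measurable_itv.
have muJ : mu (tbox J) = ((d + d) ^+ n)%:E.
  apply: lebesgue_tbox => // i; rewrite /J lebesgue_measure_itv /= lte_fin.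
  rewrite ltrBlDr -addrA ltrDl addr_gt0 //.
  by rewrite -EFinB; congr EFin; ring.
suff : mu (tbox J) = 0%E.
  by rewrite muJ => -[/eqP]; rewrite expf_eq0 gt_eqF ?andbF // addr_gt0.
apply: measure_negligible; first exact: measurable_tbox.
apply: negligibleS ae0 => z Jz /= zP.
have [] := dB (\row_i tnth z i).
  split=> // a i; rewrite ord1 !mxE; have := Jz i.
  by rewrite /J /= in_itv /= /ball /= => /andP[]; rewrite ltr_distlC => -> ->.
rewrite (_ : [tuple _ | _ < _] = z); last first.
  by apply: eq_from_tnth => i; rewrite tnth_mktuple mxE.
move=> fz [z0 z1]; have Dz : Delta z.
  split; first by move=> i; have := z0 i; rewrite mxE => /ltW.
  by apply: ltW; apply: le_lt_trans z1; apply: ler_sum => i _; rewrite mxE.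
by move: fz; case: (zP Dz) => ->; rewrite eqxx.
Qed.

End ReferenceSimplex.

(** * Integrals of forms *)

Section FormIntegrals.
Variables (R : realType) (m n : nat) (T : simplex R m n).
Local Notation C := R[i].
Local Notation RT := (measurableTypeR R).
Local Notation mu := (lebesgue_tuple R n).
Local Notation Delta := (@refsimplex R n).
Implicit Types (y : n.-tuple RT).
Local Notation Re := (@complex.Re R).
Local Notation Im := (@complex.Im R).

Definition ctame (g : n.-tuple RT -> C) :=
  tame (fun y => Re (g y)) /\ tame (fun y => Im (g y)).

Lemma ctame_cst c : ctame (fun=> c).
Proof. by split; exact: tame_cst. Qed.

Lemma ctame_real f : tame f -> ctame (fun y => (f y)%:C).
Proof. by move=> tf; split => //; exact: tame_cst. Qed.

Lemma ctameD g h : ctame g -> ctame h -> ctame (fun y => g y + h y).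
Proof.
move=> [g1 g2] [h1 h2]; split.
  rewrite (_ : (fun y => _) = fun y => Re (g y) + Re (h y)); first exact: tameD.
  by apply/funext => y; case: (g y) => ? ?; case: (h y).
rewrite (_ : (fun y => _) = fun y => Im (g y) + Im (h y)); first exact: tameD.
by apply/funext => y; case: (g y) => ? ?; case: (h y).
Qed.

Lemma ctameM g h : ctame g -> ctame h -> ctame (fun y => g y * h y).
Proof.
move=> [g1 g2] [h1 h2]; split.
  rewrite (_ : (fun y => _) = fun y => Re (g y) * Re (h y) + - (Im (g y) * Im (h y))).
    by apply: tameD; last apply: tameN; apply: tameM.
  by apply/funext => y; case: (g y) => ? ?; case: (h y).
rewrite (_ : (fun y => _) = fun y => Re (g y) * Im (h y) + Im (g y) * Re (h y)).
  by apply: tameD; apply: tameM.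
by apply/funext => y; case: (g y) => ? ?; case: (h y) => ? ? /=; rewrite addrC.
Qed.

Lemma ctame_conj g : ctame g -> ctame (fun y => (g y)^*).
Proof.
move=> [g1 g2]; split.
  rewrite (_ : (fun y => _) = fun y => Re (g y)) //.
  by apply/funext => y; case: (g y).
rewrite (_ : (fun y => _) = fun y => - Im (g y)); first exact: tameN.
by apply/funext => y; case: (g y).
Qed.

Lemma ctame_sum (I : Type) (s : seq I) (P : pred I) (g : I -> n.-tuple RT -> C) :
  (forall i, P i -> ctame (g i)) -> ctame (fun y => \sum_(i <- s | P i) g i y).
Proof.
move=> tf; elim: s => [|i s IH].
  rewrite (_ : (fun y => _) = fun=> 0); first exact: ctame_cst.
  by apply/funext => y; rewrite big_nil.
rewrite (_ : (fun y => _) = fun y => (if P i then g i y else 0) +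
    \sum_(i <- s | P i) g i y); last first.
  by apply/funext => y; rewrite big_cons; case: ifP; rewrite ?add0r.
by apply: ctameD => //; have := tf i; case: (P i) => [tfi|_]; [exact: tfi|exact: ctame_cst].
Qed.

Lemma ctame_prod (I : Type) (s : seq I) (P : pred I) (g : I -> n.-tuple RT -> C) :
  (forall i, ctame (g i)) -> ctame (fun y => \prod_(i <- s | P i) g i y).
Proof.
move=> tf; elim: s => [|i s IH].
  rewrite (_ : (fun y => _) = fun=> 1); first exact: ctame_cst.
  by apply/funext => y; rewrite big_nil.
rewrite (_ : (fun y => _) = fun y => (if P i then g i y else 1) *
    \prod_(i <- s | P i) g i y); last first.
  by apply/funext => y; rewrite big_cons; case: ifP; rewrite ?mul1r.
by apply: ctameM => //; case: (P i); [exact: tf|exact: ctame_cst].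
Qed.

Lemma ctameX g k : ctame g -> ctame (fun y => g y ^+ k).
Proof.
move=> tg; elim: k => [|k IH]; first exact: ctame_cst.
rewrite (_ : (fun y => _) = fun y => g y * g y ^+ k); first exact: ctameM.
by apply/funext => y; rewrite exprS.
Qed.

Lemma bary_chart y (i : 'I_n.+1) :
  bary T i (chart T y) =
  if unlift ord0 i is Some j then tnth y j else 1 - \sum_(j < n) tnth y j.
Proof.
rewrite /bary /chart addrC addKr -mulmxA mulmxVp; last exact: (affinely_independent T).
rewrite mulmx1; case: unliftP => [j|] _; first by rewrite mxE.
by under eq_bigr do rewrite mxE.
Qed.

Lemma bary_ge0 y i : Delta y -> 0 <= bary T i (chart T y).
Proof.
by move=> [y0 y1]; rewrite bary_chart; case: unliftP => [j|] _; rewrite ?subr_ge0.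
Qed.

Lemma chart_simplex y : Delta y -> simplex_set T (chart T y).
Proof.
move=> Dy; exists (fun i => bary T i (chart T y)); split.
- by move=> i; exact: bary_ge0.
- exact: sum_bary.
- rewrite big_ord_recl /= bary_chart unlift_none scalerBl scale1r.
  under [in RHS]eq_bigr do rewrite bary_chart liftK.
  rewrite /chart mulmx_sum_row -addrA; congr (_ + _); rewrite addrC scaler_suml -sumrB.
  by apply: eq_bigr => i _; rewrite rowK mxE scalerBr.
Qed.

Definition tame_fun (f : 'rV[R]_m -> C) := ctame (fun y => f (chart T y)).
Definition tame_form d (a : dform R m d) := forall U, ctame (fun y => a (chart T y) U).

Lemma tame_lambda i : tame_fun (lambda T i).
Proof.
apply: ctame_real.
rewrite (_ : (fun y => _) = fun y => if unlift ord0 i is Some j then tnth y j : R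
  else 1 + - \sum_(j < n) tnth y j); last by apply/funext => y; rewrite bary_chart.
case: unlift => [j|]; first exact: tame_tnth.
apply: tameD; first exact: tame_cst.
by apply: tameN; apply: tame_sum => j _; exact: tame_tnth.
Qed.

Lemma tame_lambda_pow a : tame_fun (lambda_pow T a).
Proof. by apply: ctame_prod => i; apply: ctameX; exact: tame_lambda. Qed.

Lemma tame_lambda_prod d (s : {ffun 'I_d -> 'I_n.+1}) : tame_fun (lambda_prod T s).
Proof. by apply: ctame_prod => i; exact: tame_lambda. Qed.

Lemma tame_scale d f (a : dform R m d) : tame_fun f -> tame_form a ->
  tame_form (form_scale f a).
Proof. by move=> tf ta U; apply: ctameM. Qed.

Lemma tame_dlambda d (s : {ffun 'I_d -> 'I_n.+1}) : tame_form (dlambda T s).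
Proof. by move=> U; rewrite dlambdaE; exact: ctame_cst. Qed.

Lemma tame_form_sum (I : Type) (s : seq I) (P : pred I) d (a : I -> dform R m d) :
  (forall i, P i -> tame_form (a i)) -> tame_form (\sum_(i <- s | P i) a i).
Proof.
move=> ta U; rewrite (_ : (fun y => _) = fun y => \sum_(i <- s | P i) a i (chart T y) U).
  by apply: ctame_sum => i Pi; exact: ta.
by apply/funext => y; rewrite dform_sumE.
Qed.

Lemma tame_whitney d (s : {ffun 'I_d.+1 -> 'I_n.+1}) : tame_form (whitney T s).
Proof.
apply: tame_form_sum => p _; apply: tame_scale; last exact: tame_dlambda.
by apply: ctameM; [exact: ctame_cst|exact: tame_lambda].
Qed.

Lemma tame_wedge d e (a : dform R m d) (b : dform R m e) :
  tame_form a -> tame_form b -> tame_form (wedge a b).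
Proof.
move=> ta tb U; apply: ctameM; first exact: ctame_cst.
by apply: ctame_sum => s _; apply: ctameM; [exact: ctame_cst|exact: ctameM].
Qed.

Lemma tame_cast d e (de : d = e) (a : dform R m d) :
  tame_form a -> tame_form (form_cast de a).
Proof. by move=> ta U; exact: ta. Qed.

Lemma form_integral0 : form_integral T 0 = 0.
Proof.
rewrite /form_integral /= [X in _ * (X +i* _)](_ : _ = 0); last first.
  by rewrite Rintegral_cst ?mul0r //; exact: measurable_refsimplex.
rewrite [X in _ * (_ +i* X)](_ : _ = 0) ?mulr0 //.
by rewrite Rintegral_cst ?mul0r //; exact: measurable_refsimplex.
Qed.

Lemma form_integralD (a b : dform R m n) : tame_form a -> tame_form b ->
  form_integral T (a + b) = form_integral T a + form_integral T b.
Proof.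
move=> /(_ (edges T)) [a1 a2] /(_ (edges T)) [b1 b2].
rewrite /form_integral -mulrDr; congr (_ * _).
have mD := @measurable_refsimplex R n.
have E1 : \int[mu]_(y in Delta) Re ((a + b) (chart T y) (edges T)) =
  \int[mu]_(y in Delta) Re (a (chart T y) (edges T)) +
  \int[mu]_(y in Delta) Re (b (chart T y) (edges T)).
  rewrite -RintegralD //; try exact: tame_integrable.
  apply: eq_Rintegral => y _; rewrite dformD.
  by case: (a _ _) => ? ?; case: (b _ _).
have E2 : \int[mu]_(y in Delta) Im ((a + b) (chart T y) (edges T)) =
  \int[mu]_(y in Delta) Im (a (chart T y) (edges T)) +
  \int[mu]_(y in Delta) Im (b (chart T y) (edges T)).
  rewrite -RintegralD //; try exact: tame_integrable.
  apply: eq_Rintegral => y _; rewrite dformD.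
  by case: (a _ _) => ? ?; case: (b _ _).
by rewrite E1 E2.
Qed.

Lemma form_integral_sum (I : Type) (s : seq I) (P : pred I) (a : I -> dform R m n) :
  (forall i, P i -> tame_form (a i)) ->
  form_integral T (\sum_(i <- s | P i) a i) = \sum_(i <- s | P i) form_integral T (a i).
Proof.
move=> ta; elim: s => [|i s IH]; first by rewrite !big_nil form_integral0.
rewrite !big_cons; case: ifP => // Pi.
by rewrite form_integralD ?IH //; [exact: ta|exact: tame_form_sum].
Qed.

Lemma eq_form_integral (a b : dform R m n) :
  (forall y, Delta y -> a (chart T y) (edges T) = b (chart T y) (edges T)) ->
  form_integral T a = form_integral T b.
Proof.
move=> ab; rewrite /form_integral; congr (_ * (_ +i* _));
  by apply: eq_Rintegral => y /set_mem Dy; rewrite ab.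
Qed.

Lemma form_integral_ge0 (a : dform R m n) :
  (forall y, Delta y -> 0 <= a (chart T y) (edges T)) ->
  0 <= (-1) ^+ reversed T * form_integral T a.
Proof.
move=> a0; rewrite /form_integral mulrA -expr2 sqrr_sign mul1r.
rewrite lecE /=; apply/andP; split.
  rewrite (@eq_Rintegral _ _ _ _ _ (fun=> 0)).
    by rewrite Rintegral_cst ?mul0r //; exact: measurable_refsimplex.
  by move=> y /set_mem/a0; rewrite lecE => /andP[/eqP].
by apply: Rintegral_ge0 => y /a0; rewrite lecE => /andP[].
Qed.

Lemma form_integral_eq0 (a : dform R m n) : tame_form a ->
  (forall y, Delta y -> 0 <= a (chart T y) (edges T)) ->
  form_integral T a = 0 ->
  forall y, (forall i, 0 < tnth y i) -> \sum_i tnth y i < 1 ->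
    a (chart T y) (edges T) = 0.
Proof.
move=> /(_ (edges T)) [ta _] a0 /eqP; rewrite mulf_eq0 signr_eq0 /= => /eqP[Ia _] y y0 y1.
have Dy : Delta y by split; [move=> i; exact/ltW|exact/ltW].
have Ra : Re (a (chart T y) (edges T)) = 0.
  apply: (tame_integral0 ta) => // z /a0.
  by rewrite lecE => /andP[].
have := a0 y Dy; rewrite lecE => /andP[/eqP Ima _].
by move: Ra Ima; case: (a _ _) => u v /= -> ->.
Qed.

End FormIntegrals.

(** * The integral identity *)

Section Wedge.
Variables (R : realType) (m : nat).

Lemma wedge_suml (I : Type) (s : seq I) (P : pred I) d e (a : I -> dform R m d)
    (b : dform R m e) x U :
  wedge (\sum_(i <- s | P i) a i) b x U = \sum_(i <- s | P i) wedge (a i) b x U.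
Proof.
rewrite /wedge -mulr_sumr exchange_big /=; congr (_ * _); apply: eq_bigr => t _.
by rewrite -mulr_sumr dform_sumE mulr_suml.
Qed.

Lemma wedge_sumr (I : Type) (s : seq I) (P : pred I) d e (a : dform R m d)
    (b : I -> dform R m e) x U :
  wedge a (\sum_(i <- s | P i) b i) x U = \sum_(i <- s | P i) wedge a (b i) x U.
Proof.
rewrite /wedge -mulr_sumr exchange_big /=; congr (_ * _); apply: eq_bigr => t _.
by rewrite -!mulr_sumr dform_sumE.
Qed.

Lemma wedge_scale d e f g (a : dform R m d) (b : dform R m e) x U :
  wedge (form_scale f a) (form_scale g b) x U = f x * g x * wedge a b x U.
Proof.
rewrite /wedge [RHS]mulrCA [X in _ = _ * X]mulr_sumr; congr (_ * _); apply: eq_bigr => s _.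
by rewrite /form_scale [RHS]mulrCA mulrACA.
Qed.

Lemma wedge_eq0 d e (a : dform R m d) (b : dform R m e) x r (V : 'M[R]_(r, m)) U :
  (U <= V)%MS ->
  (forall U, (U <= V)%MS -> a x U = 0) \/ (forall U, (U <= V)%MS -> b x U = 0) ->
  wedge a b x U = 0.
Proof.
move=> UV ab; rewrite /wedge big1 ?mulr0 // => s _.
have : (row_perm s U <= V)%MS by rewrite row_permE; exact: submx_trans (submxMl _ _) UV.
rewrite -[row_perm s U in X in X -> _]vsubmxK col_mx_sub => /andP[Ul Ur].
by case: ab => ->; rewrite ?(mul0r, mulr0).
Qed.

Lemma castmx_sub d e (de : d = e) r (U : 'M[R]_(d, m)) (V : 'M[R]_(r, m)) :
  (castmx (de, erefl m) U <= V)%MS = (U <= V)%MS.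
Proof. by subst e; rewrite castmx_id. Qed.

End Wedge.

Section Pairing.
Variables (R : realType) (m n r k : nat) (hk : (k <= n)%N) (T : simplex R m n).
Local Notation C := R[i].
Variable omega : {ffun 'I_n.+1 -> nat} -> {ffun 'I_k -> 'I_n.+1} -> C.
Local Notation E := (shuffle C).
Local Notation D d A := (dlambda T (incr d A)).
Implicit Types (A B : {set 'I_n.+1}) (x : 'rV[R]_m).

Let om a A := omega a (incr k A).

(** The coefficient, at the point x, of the basis form indexed by A. *)
Definition poly_coef x A : C := \sum_(a <- multis r n) om a A * lambda_pow T a x.

Local Notation S x B := (ext_mul (fun i => lambda T i x) (poly_coef x) B).

Lemma lambda_pow_madd a p x : lambda_pow T (madd a p) x = lambda T p x * lambda_pow T a x.
Proof.
rewrite /lambda_pow (bigD1 p) //= [X in _ = _ * X](bigD1 p) //= mulrA -exprS.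
rewrite ffunE eqxx addn1; congr (_ * _); apply: eq_bigr => i /negbTE ip.
by rewrite ffunE ip addn0.
Qed.

Lemma ext_mul_multis B x :
  \sum_(b <- multis r.+1 n) \sum_(p in B :&: msupp b)
     E [set p] (B :\ p) * lambda_pow T b x * om (msub b p) (B :\ p) = S x B.
Proof.
under eq_bigr do under eq_bigl do rewrite inE.
rewrite (exchange_big_dep (mem B)) /=; last by move=> ? ? _ /andP[].
apply: eq_bigr => p pB; rewrite pB /= sum_multis_madd mulr_sumr.
apply: eq_bigr => a _; rewrite maddK lambda_pow_madd /om; ring.
Qed.

Lemma ext_mul_koszul B x :
  S x B = \sum_(b <- multis r.+1 n) koszul om b B * lambda_pow T b x.
Proof.
rewrite -ext_mul_multis; apply: eq_bigr => b _; rewrite mulr_suml.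
by apply: eq_bigr => p _; ring.
Qed.

Lemma card_setC A j : #|A| = j -> #|~: A| = (n.+1 - j)%N.
Proof. by move=> Aj; rewrite cardsCs finset.setCK Aj card_ord. Qed.

Lemma lambda_prod_set d A x : #|A| = d ->
  lambda_prod T (incr d A) x = \prod_(i in A) lambda T i x.
Proof. by move=> Ad; rewrite /lambda_prod (prod_incr (fun i => lambda T i x)). Qed.

Definition dlambda_form : dform R m k :=
  \sum_(a <- multis r n) \sum_(s in incmaps k n)
     form_scale (fun x => omega a s * lambda_pow T a x
                          * lambda_prod T (compl (n - k).+1 s) x) (dlambda T s).

Definition whitney_form : dform R m (n - k) :=
  \sum_(a <- multis r n) \sum_(s in incmaps k n)
     form_scale (fun x => eps s (compl (n - k).+1 s) * omega a s * lambda_pow T a x)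
       (whitney T (compl (n - k).+1 s)).

(** The complex conjugate of [whitney_form], see [whitney_form_conjE]. *)
Definition whitney_form_conj : dform R m (n - k) :=
  \sum_(a <- multis r n) \sum_(s in incmaps k n)
     form_scale (fun x => eps s (compl (n - k).+1 s) * (omega a s)^* * lambda_pow T a x)
       (whitney T (compl (n - k).+1 s)).

Lemma dlambda_formE x U : dlambda_form x U = \sum_(A : {set 'I_n.+1} | #|A| == k)
  poly_coef x A * compl_prod (fun i => lambda T i x) A * D k A x U.
Proof.
rewrite /dlambda_form dform_sumE; under eq_bigr do rewrite dform_sumE sum_incmaps.
rewrite exchange_big /=; apply: eq_bigr => A /eqP Ak.
rewrite /poly_coef !mulr_suml; apply: eq_bigr => a _.
rewrite /form_scale /compl img_incr // lambda_prod_set //.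
by rewrite (card_setC Ak) subSn.
Qed.

Lemma eps_compl A : #|A| = k ->
  eps (incr k A) (compl (n - k).+1 (incr k A)) = E A (~: A).
Proof.
move=> Ak; have cA : #|~: A| = (n - k).+1 by rewrite (card_setC Ak) subSn.
by rewrite /compl eps_shuffle ?img_incr ?incr_incmaps.
Qed.

Lemma whitney_formE x U : whitney_form x U = (-1) ^+ k *
  \sum_(B : {set 'I_n.+1} | #|B| == k.+1) E B (~: B) * S x B * D (n - k) (~: B) x U.
Proof.
rewrite -(whitney_expansion (fun i => lambda T i x) (poly_coef x) k
  (fun A => D (n - k) A x U)).
rewrite /whitney_form dform_sumE; under eq_bigr do rewrite dform_sumE sum_incmaps.
rewrite exchange_big /=; apply: eq_bigr => A /eqP Ak.
rewrite -[RHS]mulrA [RHS]mulrCA /poly_coef mulr_suml; apply: eq_bigr => a _.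
rewrite /form_scale eps_compl // /compl img_incr // whitney_set.
  by rewrite /om; ring.
by rewrite (card_setC Ak) subSn.
Qed.

Lemma conj_lambda_pow a x : (lambda_pow T a x)^* = lambda_pow T a x.
Proof.
rewrite /lambda_pow rmorph_prod; apply: eq_bigr => i _.
by rewrite rmorphXn; congr (_ ^+ _); exact: conjc_real.
Qed.

Lemma whitney_form_conjE x U : whitney_form_conj x U = (whitney_form x U)^*.
Proof.
rewrite /whitney_form_conj /whitney_form !dform_sumE rmorph_sum; apply: eq_bigr => a _.
rewrite !dform_sumE rmorph_sum !sum_incmaps; apply: eq_bigr => A /eqP Ak.
rewrite /form_scale eps_compl // !rmorphM; congr (_ * _ * _ * _).
- exact/esym/conj_shuffle.
- exact/esym/conj_lambda_pow.
- rewrite /compl img_incr //; apply/esym/conj_whitney.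
  by rewrite (card_setC Ak) subSn.
Qed.

(** The integrand of the bilinear expression of the theorem. *)
Definition pairing_form : dform R m n :=
  form_cast (subnKC hk) (wedge dlambda_form whitney_form_conj).

(** The Whitney expansion of the second factor exhibits the conjugates of the
    coefficients S_B; pairing its basis forms with the first factor produces S_B a
    second time. *)
Lemma pairing_form_edges x : pairing_form x (edges T) = (-1) ^+ k *
  \sum_(B : {set 'I_n.+1} | #|B| == k.+1)
    compl_prod (fun i => lambda T i x) B * `|S x B| ^+ 2.
Proof.
have EB : dlambda_form = \sum_(A : {set 'I_n.+1} | #|A| == k) form_scale
    (fun x => poly_coef x A * compl_prod (fun i => lambda T i x) A) (D k A).
  by apply/funext => z; apply/funext => U; rewrite dlambda_formE dform_sumE.
have EA : whitney_form_conj = \sum_(B : {set 'I_n.+1} | #|B| == k.+1) form_scale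
    (fun x => (-1) ^+ k * (E B (~: B) * (S x B)^*)) (D (n - k) (~: B)).
  apply/funext => z; apply/funext => U; rewrite whitney_form_conjE whitney_formE dform_sumE.
  rewrite mulr_sumr rmorph_sum; apply: eq_bigr => B _.
  rewrite !rmorphM /form_scale -!mulrA; congr (_ * (_ * (_ * _))).
  - exact: rmorph_sign.
  - exact: conj_shuffle.
  - exact: conj_dlambda.
rewrite /pairing_form /form_cast EB EA wedge_sumr mulr_sumr; apply: eq_bigr => B /eqP Bk.
rewrite wedge_suml.
have cB : #|~: B| = (n - k)%N by rewrite (card_setC Bk) subSS.
transitivity ((-1) ^+ k * (E B (~: B) * (S x B)^*) *
   \sum_(A : {set 'I_n.+1} | #|A| == k) poly_coef x A *
     compl_prod (fun i => lambda T i x) A *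
     form_cast (subnKC hk) (wedge (D k A) (D (n - k) (~: B))) x (edges T)).
  rewrite mulr_sumr; apply: eq_bigr => A _.
  by rewrite wedge_scale /form_cast; ring.
rewrite (sum_pairing _ _ (W := fun A B' => form_cast (subnKC hk)
  (wedge (D k A) (D (n - k) B')) x (edges T)) Bk); last first.
  by move=> A Ak; rewrite wedge_edges.
rewrite sqr_normc -!mulrA; congr (_ * _).
have := shuffle_sqr C (disj_setC B) => e2.
by rewrite -[RHS]mul1r -e2; ring.
Qed.

Definition square_form (h : {ffun 'I_k.+1 -> 'I_n.+1}) : dform R m n :=
  form_scale (fun x => lambda_prod T (compl (n - k) h) x *
     `| \sum_(b <- multis r.+1 n) \sum_(p in img h :&: msupp b)
          eps1 p (sminus h p) * lambda_pow T b x * omega (msub b p) (sminus h p) | ^+ 2)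
   (whitneyT T).

Lemma square_form_edges B x : #|B| = k.+1 -> square_form (incr k.+1 B) x (edges T) =
  compl_prod (fun i => lambda T i x) B * `|S x B| ^+ 2.
Proof.
move=> Bk; rewrite /square_form /form_scale whitneyT_edges mulr1 /compl img_incr //.
rewrite lambda_prod_set; last by rewrite (card_setC Bk) subSS.
congr (_ * `|_| ^+ 2); rewrite -ext_mul_multis; apply: eq_bigr => b _.
apply: eq_bigr => p /setIP[pB _].
have cp : #|B :\ p| = k by move: Bk; rewrite (cardsD1 p) pB => -[].
by rewrite /sminus img_incr // eps1_shuffle ?incr_incmaps // img_incr.
Qed.

Lemma tame_square_form h : tame_form T (square_form h).
Proof.
apply: tame_scale; last exact: tame_whitney.
apply: ctameM; first exact: tame_lambda_prod.
rewrite (_ : (fun y => _) = fun y : n.-tuple (measurableTypeR R) =>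
  let z := \sum_(b <- multis r.+1 n) \sum_(p in img h :&: msupp b)
    eps1 p (sminus h p) * lambda_pow T b (chart T y)
      * omega (msub b p) (sminus h p) in z * z^*); last first.
  by apply/funext => y; rewrite sqr_normc.
have tz : ctame (fun y : n.-tuple (measurableTypeR R) =>
    \sum_(b <- multis r.+1 n) \sum_(p in img h :&: msupp b)
    eps1 p (sminus h p) * lambda_pow T b (chart T y)
      * omega (msub b p) (sminus h p)).
  apply: ctame_sum => b _; apply: ctame_sum => p _.
  apply: ctameM; last exact: ctame_cst.
  by apply: ctameM; [exact: ctame_cst|exact: tame_lambda_pow].
by apply: ctameM => //; exact: ctame_conj.
Qed.

Lemma form_integral_pairing :
  \sum_(a <- multis r n) \sum_(b <- multis r n)
    \sum_(s in incmaps k n) \sum_(t in incmaps k n)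
      form_integral T (form_cast (subnKC hk)
        (wedge
          (form_scale
             (fun x => omega a s * lambda_pow T a x
                       * lambda_prod T (compl (n - k).+1 s) x)
             (dlambda T s))
          (form_scale
             (fun x => eps t (compl (n - k).+1 t) * (omega b t)^*
                       * lambda_pow T b x)
             (whitney T (compl (n - k).+1 t)))))
  = form_integral T pairing_form.
Proof.
set F := fun a b s t => form_cast (subnKC hk) (wedge
  (form_scale (fun x => omega a s * lambda_pow T a x
     * lambda_prod T (compl (n - k).+1 s) x) (dlambda T s))
  (form_scale (fun x => eps t (compl (n - k).+1 t) * (omega b t)^* * lambda_pow T b x)
     (whitney T (compl (n - k).+1 t)))).
have tF a b s t : tame_form T (F a b s t).
  apply: tame_cast; apply: tame_wedge; apply: tame_scale.
  - apply: ctameM; last exact: tame_lambda_prod.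
    by apply: ctameM; [exact: ctame_cst|exact: tame_lambda_pow].
  - exact: tame_dlambda.
  - apply: ctameM; last exact: tame_lambda_pow.
    exact: ctame_cst.
  - exact: tame_whitney.
transitivity (form_integral T (\sum_(a <- multis r n) \sum_(b <- multis r n)
    \sum_(s in incmaps k n) \sum_(t in incmaps k n) F a b s t)).
  do 4![rewrite form_integral_sum; [apply: eq_bigr => ? _|
    by move=> ? _; do ?[apply: tame_form_sum => ? _]; exact: tF]].
  by [].
apply: eq_form_integral => y _; rewrite /pairing_form /form_cast /dlambda_form /whitney_form_conj.
rewrite wedge_suml dform_sumE; apply: eq_bigr => a _.
rewrite wedge_sumr dform_sumE; apply: eq_bigr => b _.
rewrite wedge_suml dform_sumE; apply: eq_bigr => s _.
by rewrite wedge_sumr dform_sumE.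
Qed.

Lemma form_integral_sign j (a : dform R m n) : tame_form T a ->
  form_integral T (form_scale (fun=> (-1) ^+ j) a) = (-1) ^+ j * form_integral T a.
Proof.
move=> ta; elim: j => [|j IH].
  by rewrite mul1r; apply: eq_form_integral => y _; rewrite /form_scale mul1r.
have ts i : tame_form T (form_scale (fun=> (-1) ^+ i) a).
  by apply: tame_scale => //; exact: ctame_cst.
have sum0 : form_integral T (form_scale (fun=> (-1) ^+ j.+1) a) +
    form_integral T (form_scale (fun=> (-1) ^+ j) a) = 0.
  rewrite -form_integralD // -[RHS](form_integral0 T); apply: eq_form_integral => y _.
  by rewrite dformD /form_scale exprS mulN1r mulNr addNr.
by rewrite [in RHS]exprS mulN1r mulNr -IH; apply/eqP; rewrite -addr_eq0 sum0.
Qed.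

Lemma form_integral_squares : form_integral T pairing_form =
  (-1) ^+ k * \sum_(h in incmaps k.+1 n) form_integral T (square_form h).
Proof.
rewrite -form_integral_sum; last by move=> h _; exact: tame_square_form.
rewrite -form_integral_sign; last by apply: tame_form_sum => h _; exact: tame_square_form.
apply: eq_form_integral => y _; rewrite pairing_form_edges /form_scale dform_sumE.
by rewrite sum_incmaps; congr (_ * _); apply: eq_bigr => B /eqP Bk; rewrite square_form_edges.
Qed.

End Pairing.

(** * The vanishing conditions *)

Section Vanishing.
Variables (R : realType) (m n r k : nat) (hk : (k <= n)%N) (T : simplex R m n).
Local Notation C := R[i].
Variable omega : {ffun 'I_n.+1 -> nat} -> {ffun 'I_k -> 'I_n.+1} -> C.
Local Notation E := (shuffle C).
Local Notation om := (fun a (A : {set 'I_n.+1}) => omega a (incr k A)).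
Local Notation S x B := (ext_mul (fun i => lambda T i x) (poly_coef r T omega x) B).
Implicit Types (A B : {set 'I_n.+1}) (x : 'rV[R]_m).

(** The interior of the simplex in barycentric coordinates. *)
Lemma chart_onto (w : 'I_n.+1 -> C) : (forall i, 0 < w i) -> \sum_i w i = 1 ->
  exists y : n.-tuple (measurableTypeR R),
    [/\ forall j, 0 < tnth y j, \sum_j tnth y j < 1 &
        forall i, lambda T i (chart T y) = w i].
Proof.
move=> w0 w1; pose v i := complex.Re (w i).
have wv i : w i = (v i)%:C.
  by have := w0 i; rewrite ltcE /v => /andP[/eqP]; case: (w i) => a b /= ->.
have v0 i : 0 < v i by have := w0 i; rewrite wv ltcR.
have v1 : \sum_i v i = 1.
  by apply: complexI; rewrite rmorph_sum /= -[RHS]w1; apply: eq_bigr => i _; rewrite wv.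
have sv : \sum_(j < n) v (lift ord0 j) = 1 - v ord0.
  by rewrite -v1 big_ord_recl addrC addKr.
exists [tuple v (lift ord0 j) | j < n]; split.
- by move=> j; rewrite tnth_mktuple.
- by under eq_bigr do rewrite tnth_mktuple; rewrite sv gtrBl.
- move=> i; rewrite /lambda bary_chart wv; congr (_%:C).
  case: unliftP => [j|] ->; first by rewrite tnth_mktuple.
  by under eq_bigr do rewrite tnth_mktuple; rewrite sv subKr.
Qed.

Lemma ext_mul_eq0 :
  (forall b B, b \in multis r.+1 n -> #|B| = k.+1 -> koszul om b B = 0) ->
  forall x B, #|B| = k.+1 -> S x B = 0.
Proof.
move=> K x B Bk; rewrite ext_mul_koszul big_seq big1 // => b br.
by rewrite K // mul0r.
Qed.

(** The integrands of the sum of squares are nonnegative, so that each of them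
    vanishes at the interior points of T, where the factor of the square is
    positive. The vanishing polynomial under the square has the coefficients
    [koszul om b B], and its monomials are independent on the interior. *)
Lemma koszul_eq0 : form_integral T (pairing_form r hk T omega) = 0 ->
  forall b B, b \in multis r.+1 n -> #|B| = k.+1 -> koszul om b B = 0.
Proof.
rewrite form_integral_squares => /eqP; rewrite mulf_eq0 signr_eq0 /= => /eqP IG b B br Bk.
have G0 (h : {ffun 'I_k.+1 -> 'I_n.+1}) (y : n.-tuple (measurableTypeR R)) :
    h \in incmaps k.+1 n -> refsimplex y ->
    0 <= square_form r T omega h (chart T y) (edges T).
  move=> hP Dy; rewrite -(incr_img hP) square_form_edges ?card_incmaps //.
  apply: mulr_ge0; last exact: exprn_ge0.
  by apply: prodr_ge0 => i _; rewrite lecR; exact: bary_ge0.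
have {}IG h : h \in incmaps k.+1 n -> form_integral T (square_form r T omega h) = 0.
  move=> hP; have /psumr_eq0P : forall h, h \in incmaps k.+1 n ->
      0 <= (-1) ^+ reversed T * form_integral T (square_form r T omega h).
    by move=> h' h'P; apply: form_integral_ge0 => y; exact: G0.
  rewrite -mulr_sumr IG mulr0 => /(_ erefl h hP)/eqP.
  by rewrite mulf_eq0 signr_eq0 => /eqP.
move: b br; apply: monomials_free => w w0 w1.
have [y [y0 y1 yw]] := chart_onto w0 w1.
have hP := incr_incmaps Bk.
have := form_integral_eq0 (tame_square_form _ _ _ _) (fun z => G0 _ z hP) (IG _ hP) y0 y1.
rewrite square_form_edges // => /eqP; rewrite mulf_eq0 expf_eq0 /= normr_eq0.
have /negbTE -> /= : compl_prod (fun i => lambda T i (chart T y)) B != 0.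
  by apply/prodf_neq0 => i _; rewrite yw gt_eqF.
rewrite ext_mul_koszul => /eqP e0; rewrite -[RHS]e0; apply: eq_bigr => b _.
by congr (_ * _); apply: eq_bigr => i _; rewrite yw.
Qed.

Lemma whitney_form_eq0 : (forall x B, #|B| = k.+1 -> S x B = 0) ->
  forall x U, whitney_form r T omega x U = 0.
Proof.
move=> S0 x U; rewrite whitney_formE // big1 ?mulr0 // => B /eqP Bk.
by rewrite S0 // mulr0 mul0r.
Qed.

Lemma dlambda_form_eq0 : (forall x B, #|B| = k.+1 -> S x B = 0) ->
  forall x U, dlambda_form r T omega x U = 0.
Proof.
move=> S0 x U; rewrite dlambda_formE //.
apply: (sum_kernel_eq0 (D := fun A => dlambda T (incr k A) x U)).
- exact: sum_lambda.
- by move=> A Ak; case: _ / Ak U => U; exact: sum_wedge1_dlambda.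
- exact: S0.
Qed.

(** The pairing is bilinear in the two forms, up to conjugation. *)
Lemma pairing_form_eq0 :
  form_eq T (whitney_form r T omega) 0 \/ form_eq T (dlambda_form r T omega) 0 ->
  form_integral T (pairing_form r hk T omega) = 0.
Proof.
move=> AB; rewrite -[RHS](form_integral0 T); apply: eq_form_integral => y Dy.
have cy := chart_simplex T Dy.
apply: (@wedge_eq0 _ _ _ _ _ _ _ _ (edges T)); first by rewrite castmx_sub.
case: AB => H; [right|left] => U UT; last exact: H.
by rewrite whitney_form_conjE // H // conjc0.
Qed.

End Vanishing.

Theorem theorem6p6 (R : realType) (m n r k : nat) (hk : (k <= n)%N)
    (T : simplex R m n)
    (omega : {ffun 'I_n.+1 -> nat} -> {ffun 'I_k -> 'I_n.+1} -> R[i]) :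
  let Q : R[i] :=
    \sum_(a <- multis r n) \sum_(b <- multis r n)
    \sum_(s in incmaps k n) \sum_(t in incmaps k n)
      form_integral T (form_cast (subnKC hk)
        (wedge
          (form_scale
             (fun x => omega a s * lambda_pow T a x
                       * lambda_prod T (compl (n - k).+1 s) x)
             (dlambda T s))
          (form_scale
             (fun x => eps t (compl (n - k).+1 t) * (omega b t)^*
                       * lambda_pow T b x)
             (whitney T (compl (n - k).+1 t))))) in
  Q = (-1) ^+ k *
      \sum_(h in incmaps k.+1 n)
        form_integral T
          (form_scale
             (fun x => lambda_prod T (compl (n - k) h) x *
                `| \sum_(b <- multis r.+1 n) \sum_(p in img h :&: msupp b)
                     eps1 p (sminus h p) * lambda_pow T b x
                     * omega (msub b p) (sminus h p) | ^+ 2)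
             (whitneyT T))
  /\
  [<-> Q = 0;
   form_eq T
     (\sum_(a <- multis r n) \sum_(s in incmaps k n)
        form_scale
          (fun x => eps s (compl (n - k).+1 s) * omega a s * lambda_pow T a x)
          (whitney T (compl (n - k).+1 s)))
     0;
   form_eq T
     (\sum_(a <- multis r n) \sum_(s in incmaps k n)
        form_scale
          (fun x => omega a s * lambda_pow T a x
                    * lambda_prod T (compl (n - k).+1 s) x)
          (dlambda T s))
     0;
   forall a s, a \in multis r n -> s \in incmaps k n ->
     let sc := compl (n - k).+1 s in
     (set_min (img sc) <= set_min (msupp a))%N ->
     let f : 'I_n.+1 := inord (set_min (img sc)) in
     omega a s
     - \sum_(q in img s :&: msupp a)
         eps1 f s * eps1 q (sminus s q)
         * omega (msub (madd a f) q) (sminus (splus s f) q) = 0;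
   forall b h, b \in multis r.+1 n -> h \in incmaps k.+1 n ->
     \sum_(p in img h :&: msupp b)
       eps1 p (sminus h p) * omega (msub b p) (sminus h p) = 0].
Proof.
move=> Q; pose om a A := omega a (incr k A).
have QE : Q = form_integral T (pairing_form r hk T omega) by exact: form_integral_pairing.
have dE b h : h \in incmaps k.+1 n -> \sum_(p in img h :&: msupp b)
    eps1 p (sminus h p) * omega (msub b p) (sminus h p) = koszul om b (img h).
  move=> hP; apply: eq_bigr => p /setIP[ph _].
  have cp : #|img h :\ p| = k.
    by have := card_incmaps hP; rewrite (cardsD1 p) ph => -[].
  by rewrite eps1_shuffle ?incr_incmaps // img_incr.
have cE a s : s \in incmaps k n -> 
  let sc := compl (n - k).+1 s in let f : 'I_n.+1 := inord (set_min (img sc)) in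
  omega a s - \sum_(q in img s :&: msupp a) eps1 f s * eps1 q (sminus s q)
         * omega (msub (madd a f) q) (sminus (splus s f) q) =
  let f : 'I_n.+1 := inord (set_min (~: img s)) in
  om a (img s) - \sum_(q in img s :&: msupp a) shuffle R[i] [set f] (img s)
     * shuffle R[i] [set q] (img s :\ q)
     * om (msub (madd a f) q) ((f |: img s) :\ q).
  move=> sP sc f.
  have sk := card_incmaps sP.
  have csk : #|~: img s| = (n - k).+1 by rewrite (card_setC sk) subSn.
  have imsc : img sc = ~: img s by rewrite /sc img_incr.
  have fs : f \notin img s.
    have [|g [gs ge _]] := @set_minP n (~: img s); first by rewrite -card_gt0 csk.
    by rewrite /f imsc ge inord_val; rewrite inE in gs.
  have cfs : #|f |: img s| = k.+1 by rewrite cardsU1 fs sk.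
  rewrite -imsc -/f /= /om (incr_img sP); congr (_ - _).
  apply: eq_bigr => q /setIP[qs _].
  have cq : #|img s :\ q| = k.-1.
    by have := cardsD1 q (img s); rewrite qs sk => /(congr1 predn)/= kE; rewrite [RHS]kE.
  rewrite (eps1_shuffle _ f sP) eps1_shuffle ?incr_incmaps // img_incr //.
  by rewrite /sminus /splus img_incr.
have red := koszul_reduction r om hk.
have toK : Q = 0 -> forall (b : {ffun 'I_n.+1 -> nat}) (B : {set 'I_n.+1}),
    b \in multis r.+1 n -> #|B| = k.+1 -> koszul om b B = 0.
  by rewrite QE; exact: koszul_eq0.
split; first by rewrite QE form_integral_squares.
tfae.
- by move=> /toK/ext_mul_eq0 S0 x U _ _; exact: (whitney_form_eq0 hk (S0 _ T)).
- move=> A0; have Q0 : Q = 0 by rewrite QE; apply: pairing_form_eq0; left.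
  by move: Q0 => /toK/ext_mul_eq0 S0 x U _ _; exact: (dlambda_form_eq0 hk (S0 _ T)).
- move=> B0 a s ar sP /=.
  have Q0 : Q = 0 by rewrite QE; apply: pairing_form_eq0; right.
  rewrite cE // => le.
  have [K _] := red; apply: (K (toK Q0)) => //; first exact: card_incmaps.
  move: le; rewrite img_incr // (card_setC (card_incmaps sP)) subSn //.
- move=> c b h br hP; rewrite dE //; have [_ K] := red.
  apply: K => //; last exact: card_incmaps.
  move=> a A ar Ak le; have sP := incr_incmaps Ak.
  have cA : #|~: A| = (n - k).+1 by rewrite (card_setC Ak) subSn.
  have := c a _ ar sP; rewrite /= cE // /compl !img_incr //.
  by apply.
- move=> d; rewrite QE form_integral_squares big1 ?mulr0 // => h hP.
  have S0 : forall x (B : {set 'I_n.+1}), #|B| = k.+1 ->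
      ext_mul (fun i => lambda T i x) (poly_coef r T omega x) B = 0.
    apply: ext_mul_eq0 => b B br Bk; have BP := incr_incmaps Bk.
    by have := d b _ br BP; rewrite dE // img_incr.
  rewrite -[RHS](form_integral0 T); apply: eq_form_integral => y _.
  rewrite -(incr_img hP) square_form_edges ?card_incmaps // S0 ?card_incmaps //.
  by rewrite normr0 expr0n mulr0.
Qed.
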